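(* Let $\mathbb{K}$ be a commutative ring and $V$ a free $\mathbb{K}$-module with a fixed basis $\mathcal{V}$. If $\mathtt{t}$ is an element of $\mathcal{S}(\mathcal{RT},\mathcal{V})$, then $\mathcal{O}\mathtt{t}$ admits a unique normal form (unique up to permutation of the non-root entries of the corollas).
   Context: Operad $PreLie=RT$. An $n$-tree is a finite non-empty connected acyclic graph with a distinguished vertex (the root) and a bijection between its vertices and $\{1,\ldots,n\}$ (trees are not planar); edges are oriented towards the root, and $In(\tau,i)$ is the set of edges entering vertex $i$. $\mathcal{RT}(n)$ is the set of $n$-trees, with $\mathbb{S}_n$ acting by relabelling, and $RT(n)=\mathbb{K}[\mathcal{RT}(n)]$. For $\tau\in\mathcal{RT}(m)$, $\upsilon\in\mathcal{RT}(n)$, $\tau\circ_i\upsilon=\sum_{f:In(\tau,i)\to\{1,\ldots,n\}}\tau\circ_i^f\upsilon$, where $\tau\circ_i^f\upsilon$ is obtained by substituting $\upsilon$ for vertex $i$, attaching the outgoing edge of $i$ (if any) to the root of $\upsilon$, each incoming edge $e$ to vertex $f(e)$, and relabelling with the usual shift. $S(RT,V)=\bigoplus_n(RT(n)\otimes V^{\otimes n})_{\mathbb{S}_n}$, $\Gamma(RT,V)=\bigoplus_n(RT(n)\otimes V^{\otimes n})^{\mathbb{S}_n}$ for the diagonal action ($\sigma$ relabels vertex $i$ as $\sigma(i)$ and moves the $i$-th letter to position $\sigma(i)$). With $P=RT$ and $(M\boxtimes N)(n)=\bigoplus_{i+j=n}\mathrm{Ind}_{\mathbb{S}_i\times\mathbb{S}_j}^{\mathbb{S}_n}M(i)\otimes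 N(j)$, the trace (sum over the group) is an isomorphism $\bigoplus_r(P(r)\otimes P^{\boxtimes r})_{\mathbb{S}_r}\cong\bigoplus_r(P(r)\otimes P^{\boxtimes r})^{\mathbb{S}_r}$; its inverse followed by operadic composition induces the monad multiplication $\tilde\mu:\Gamma(P,\Gamma(P,V))\to\Gamma(P,V)$. $\mathcal{S}(\mathcal{RT},\mathcal{V})$ is the basis of $S(RT,V)$ consisting of the classes $\tau(x_1,\ldots,x_n)$ of $\tau\otimes x_1\otimes\cdots\otimes x_n$ with $\tau\in\mathcal{RT}(n)$, $x_i\in\mathcal{V}$ (i.e. isomorphism classes of rooted trees decorated by $\mathcal{V}$). For such $\mathtt{t}$, $\mathcal{O}\mathtt{t}\in\Gamma(RT,V)$ is the sum of the distinct elements of the $\mathbb{S}_n$-orbit of $\tau\otimes x_1\otimes\cdots\otimes x_n$. The elements $\mathcal{O}\mathtt{t}$ form a basis of $\Gamma(RT,V)$, and orbit sums $\mathcal{O}\upsilon(\mathcal{O}\mathtt{t}_1,\ldots)\in\Gamma(RT,\Gamma(RT,V))$ are formed with respect to it. For $x\in V$, write $x$ also for $\mathcal{O}$ of the one-vertex tree decorated by $x$. $F_r$ is the $(r+1)$-tree with root $1$ and all other vertices attached directly to the root. A branch of a tree is a maximal subtree not containing the root. A normal form of $\mathcal{O}\mathtt{t}$ is an expression of $\mathcal{O}\mathtt{t}$ as an iterated composition (by $\tilde\mu$) of elements of the form $\mathcal{O}F_r(x,-,\ldots,-)$, $r\ge0$, whose root entry $x$ is an element of $\mathcal{V}$: that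 is, formal monomials $M$ defined inductively as $\mathcal{O}F_r(x,M_1,\ldots,M_r)$ with $x\in\mathcal{V}$ and $M_1,\ldots,M_r$ monomials, evaluated by $M\mapsto\tilde\mu(\mathcal{O}F_r(x,\mathrm{ev}(M_1),\ldots,\mathrm{ev}(M_r)))$ (each $\mathrm{ev}(M_i)$ is again of the form $\mathcal{O}\mathtt{t}_i$). It corresponds to the decomposition of the decorated tree $\mathtt{t}$ as the corolla formed by its root and its branches, iterated on the branches. *)

(* Defs.v *)
From HB Require Import structures.
From mathcomp Require Import all_boot all_order all_algebra all_fingroup.
From mathcomp Require Import finmap monalg.

Set Implicit Arguments.
Unset Strict Implicit.
Unset Printing Implicit Defensive.

Import GRing.Theory.

Local Open Scope ring_scope.

(* The free K-module with basis B is {malg K[B]}, its basis vectors being the *)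
(* << b >>; V is {malg K[X]}, where the choiceType X is the fixed basis.      *)
(* A tensor product of free modules is the free module on the product of the  *)
(* bases.                                                                     *)

Definition linext (K : comNzRingType) (A B : choiceType)
    (F : A -> {malg K[B]}) (v : {malg K[A]}) : {malg K[B]} :=
  \sum_(a <- msupp v) v@_a *: F a.

Lemma linext_coeff (K : comNzRingType) (A B : choiceType)
    (F : A -> {malg K[B]}) (v : {malg K[A]}) (b : B) :
  (linext F v)@_b = \sum_(a <- msupp v) v@_a * (F a)@_b.
Proof.
by rewrite raddf_sum; apply: eq_bigr => a _; rewrite /= mcoeffZ.
Qed.

(* ------------------------------------------------------------------------ *)

(* All edges of a rooted tree are oriented towards its root, so every vertex  *)
(* but the root has exactly one outgoing edge: the tree is given by the map   *)
(* sending a vertex to the target of its outgoing edge.                       *)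
Definition parent_map (T : finType) := {ffun T -> option T}.

(* p is a rooted tree with set of vertices A.                                 *)
Definition is_rtree (T : finType) (A : {set T}) (p : parent_map T) : bool :=
  [exists r in A, (p r == None) &&
     [forall i in A, connect [rel a b | p a == Some b] i r]]
  && [forall i, (i \notin A) ==> (p i == None)].

(* n-trees, with vertices 0, ..., n - 1 instead of 1, ..., n.                 *)
Record rtree (n : nat) := RTree {
  parent :> parent_map 'I_n;
  _ : is_rtree [set: 'I_n] parent
}.

HB.instance Definition _ n := [isSub for @parent n].
HB.instance Definition _ n := [Finite of rtree n by <:].

Lemma is_rtree_relabel n (s : 'S_n) (t : rtree n) :
  is_rtree [set: 'I_n]
    [ffun i => omap s (parent t ((s^-1)%g i))].
Proof.
case: t => p /= /andP[/exists_inP[r _ /andP[/eqP pr /forall_inP cr]] _].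
apply/andP; split; last by apply/forallP=> i; rewrite in_setT.
apply/exists_inP; exists (s r); first by rewrite in_setT.
rewrite ffunE permK pr eqxx /=; apply/forall_inP=> i _.
have /connectP[q pq ->] := cr ((s^-1)%g i) (in_setT _).
rewrite -{1}(permKV s i) -last_map; apply/connectP; exists (map s q) => //.
apply: homo_path pq => a b /= /eqP pab.
by rewrite ffunE permK pab.
Qed.

Definition relabel n (s : 'S_n) (t : rtree n) : rtree n :=
  RTree (is_rtree_relabel s t).

Lemma is_rtree_corolla r :
  is_rtree [set: 'I_r.+1]
    [ffun i : 'I_r.+1 => if i == ord0 then None else Some ord0].
Proof.
apply/andP; split; last by apply/forallP=> i; rewrite in_setT.
apply/exists_inP; exists ord0; first by rewrite in_setT.
rewrite ffunE !eqxx /=; apply/forall_inP=> i _.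
have [-> | ni] := eqVneq i ord0; first exact: connect0.
by apply: connect1; rewrite /= ffunE (negbTE ni).
Qed.

(* F_r                                                                        *)
Definition corolla r : rtree r.+1 := RTree (is_rtree_corolla r).

(* ------------------------------------------------------------------------ *)

(* The elements tau (x) x_1 (x) ... (x) x_n, tau an n-tree and x_i in D: a    *)
(* basis of the direct sum of the RT(n) (x) V^(x)n when D is a basis of V.    *)
Definition dtree (D : choiceType) : choiceType :=
  {n : nat & (rtree n * n.-tuple D)%type}.

Definition DTree (D : choiceType) n (t : rtree n) (x : n.-tuple D) : dtree D :=
  Tagged (fun n => (rtree n * n.-tuple D)%type) (t, x).

Definition act_dtree (D : choiceType) n (s : 'S_n)
    (u : rtree n * n.-tuple D) : dtree D :=
  DTree (relabel s u.1) [tuple tnth u.2 ((s^-1)%g i) | i < n].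

(* The distinct elements of the orbit of u.                                   *)
Definition orbit_dtree (D : choiceType) (u : dtree D) : seq (dtree D) :=
  undup [seq act_dtree s (tagged u) | s : 'S_(tag u)].

Lemma Tagged_inj (I : eqType) (T_ : I -> Type) i : injective (@Tagged I i T_).
Proof.
move=> x y E; have := congr1 (fun z => tagged_as (Tagged T_ x) z) E.
by rewrite !tagged_asE.
Qed.

Lemma DTreeE (D : choiceType) n (u : rtree n * n.-tuple D) :
  Tagged (fun n => (rtree n * n.-tuple D)%type) u = DTree u.1 u.2.
Proof. by case: u. Qed.

Lemma act_dtree_comp (D : choiceType) n (s s' : 'S_n)
    (u : rtree n * n.-tuple D) :
  act_dtree s' (tagged (act_dtree s u)) = act_dtree (s * s')%g u.
Proof.
rewrite /act_dtree /=; congr DTree.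
  apply/val_inj/ffunP=> i /=; rewrite !ffunE invMg permM.
  by case: (parent _ _) => //= j; rewrite permM.
by apply: eq_from_tnth => i; rewrite !tnth_mktuple invMg permM.
Qed.

(* F_r(x, d_1, ..., d_r), with r = size ds.                                   *)
Definition corolla_dtree (D : choiceType) (x : D) (ds : seq D) : dtree D :=
  DTree (corolla (size ds)) (in_tuple (x :: ds)).

Section Gamma.

Variables (K : comNzRingType) (X : choiceType).

(* Gamma(RT, V): the invariants of the symmetric groups.                      *)
Definition in_Gamma (v : {malg K[dtree X]}) : Prop :=
  forall n (s : 'S_n) (u : rtree n * n.-tuple X),
    v@_(act_dtree s u) = v@_(DTree u.1 u.2).

(* O t, for the class t of u = tau (x) x_1 (x) ... (x) x_n.                   *)
Definition orbit_sum (u : dtree X) : {malg K[dtree X]} :=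
  \sum_(u' <- orbit_dtree u) << u' >>.

Lemma orbit_sumE (u v : dtree X) :
  (orbit_sum u)@_v = (v \in orbit_dtree u)%:R.
Proof.
rewrite /orbit_sum raddf_sum /=.
under eq_bigr => w _ do rewrite mcoeffU.
case: (boolP (v \in _)) => vu.
  rewrite (bigD1_seq v) //= ?undup_uniq // eqxx big1 ?addr0 // => w wv.
  by rewrite (negbTE wv).
rewrite big_seq big1 // => w wu; case: eqP => // wv; by rewrite -wv wu in vu.
Qed.

Lemma orbit_sum_in_Gamma (u : dtree X) : in_Gamma (orbit_sum u).
Proof.
move=> n s v; rewrite !orbit_sumE; congr ((_ : bool)%:R).
have sub m (s' : 'S_m) (w : rtree m * m.-tuple X) :
    DTree w.1 w.2 \in orbit_dtree u -> act_dtree s' w \in orbit_dtree u.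
  rewrite !mem_undup => /imageP[s1 _ E]; case: u s1 E => k u s1 /= E.
  have km : k = m by move/(congr1 tag): E.
  case: m / km s' w E => s' w E.
  have -> : w = tagged (act_dtree s1 u).
    exact/Tagged_inj/(etrans _ E)/DTreeE.
  by rewrite act_dtree_comp; apply: image_f.
apply/idP/idP; last exact: sub.
move=> /(sub _ s^-1%g (tagged (act_dtree s v))).
rewrite act_dtree_comp mulgV => H; move: H.
have -> // : act_dtree 1%g v = DTree v.1 v.2.
rewrite /act_dtree; congr DTree.
  apply/val_inj/ffunP=> i /=; rewrite !ffunE invg1 perm1.
  by case: (parent _ _) => //= j; rewrite perm1.
by apply: eq_from_tnth => i; rewrite !tnth_mktuple invg1 perm1.
Qed.

(* upsilon (x) w_1 (x) ... (x) w_r, for w_i in Gamma(RT, V), expanded in      *)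
(* RT(r) (x) (+_n RT(n) (x) V^(x)n)^(x)r.  Since Gamma(RT, V) is a direct     *)
(* summand of +_n RT(n) (x) V^(x)n (it has the orbit sums as a basis),        *)
(* Gamma(RT, Gamma(RT, V)) is a submodule of {malg K[dtree (dtree X)]}.       *)
Definition tensor (u : dtree {malg K[dtree X]}) :
    {malg K[dtree (dtree X)]} :=
  let r := tag u in
  let: (t, w) := tagged u in
  let S := (\bigcup_(k <- enum 'I_r) msupp (tnth w k))%fset in
  \sum_(d : {ffun 'I_r -> S})
     (\prod_(k < r) (tnth w k)@_(val (d k))) *:
       << DTree t [tuple val (d k) | k < r] >>.

(* O upsilon(w_1, ..., w_r) in Gamma(RT, Gamma(RT, V)).  When the w_i are     *)
(* basis elements O t_i, distinct elements of the orbit of                    *)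
(* (upsilon, w_1, ..., w_r) give distinct tensors.                            *)
Definition orbit_sum2 (u : dtree {malg K[dtree X]}) :
    {malg K[dtree (dtree X)]} :=
  \sum_(u' <- orbit_dtree u) tensor u'.

(* ------------------------------------------------------------------------ *)

(* Basis of +_(r, n) RT(r) (x) RT^[x]r(n) (x) V^(x)n.  A basis element of     *)
(* RT^[x]r(n) is a map b : {0, ..., n-1} -> {0, ..., r-1} together with, for  *)
(* every k, a tree with set of vertices the block b^-1(k): the induced        *)
(* representation of (x)_k RT(n_k) is the sum, over the ordered partitions of *)
(* the labels into blocks of sizes n_k, of the products of the modules of     *)
(* trees labelled by the blocks.  The parent maps of the trees are collected  *)
(* into a single one, q; the type does not force q to be a tree on each       *)
(* block, but spread below only uses such elements.                           *)
Definition box_at (r n : nat) : choiceType :=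
  (rtree r * ({ffun 'I_n -> 'I_r} * parent_map 'I_n) * n.-tuple X)%type.

Definition box : choiceType := {rn : nat * nat & box_at rn.1 rn.2}.

Definition Box r n (z : box_at r n) : box :=
  Tagged (fun rn : nat * nat => box_at rn.1 rn.2)
         (z : box_at (r, n).1 (r, n).2).

(* (n_1, ..., n_r)-shuffles: the labellings by {0, ..., n-1} of the disjoint  *)
(* union of the sets {0, ..., n_k-1} that are increasing on each of them.     *)
(* They represent the cosets of the product of the S_(n_k) in S_n.            *)
Definition is_shuffle r (m : 'I_r -> nat) n
    (s : {ffun 'I_n -> {k : 'I_r & 'I_(m k)}}) : bool :=
  injectiveb s &&
  [forall i, forall j, (tag (s i) == tag (s j)) && (i < j)%N ==>
                       (nat_of_ord (tagged (s i)) < tagged (s j))%N].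

(* For subgroups H of G, the H-invariants of M are the G-invariants of the    *)
(* induced module, through the sum over the cosets; with G = S_n and H the    *)
(* product of the S_(n_k), this sends the tensor product over k of the        *)
(* (RT(n_k) (x) V^(x)n_k)^S_(n_k) to (RT^[x]r(n) (x) V^(x)n)^S_n.             *)
Definition spread (u : dtree (dtree X)) : {malg K[box]} :=
  let r := tag u in
  let: (t, d) := tagged u in
  let m (k : 'I_r) := tag (tnth d k) in
  let n := (\sum_(k < r) m k)%N in
  \sum_(s : {ffun 'I_n -> {k : 'I_r & 'I_(m k)}} | is_shuffle s)
    << Box (t,
            ([ffun i => tag (s i)],
             [ffun i => if parent (tagged (tnth d (tag (s i)))).1 (tagged (s i))
                             is Some j'
                        then [pick j | s j == Tagged (fun k => 'I_(m k)) j']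
                        else None]),
            [tuple tnth (tagged (tnth d (tag (s i)))).2 (tagged (s i))
              | i < n]) >>.

(* Diagonal action of S_r on RT(r) (x) RT^[x]r(n).                            *)
Definition act_box r n (p : 'S_r) (z : box_at r n) : box :=
  Box (relabel p z.1.1, ([ffun i => p (z.1.2.1 i)], z.1.2.2), z.2).

Definition orbit_box (z : box) : seq box :=
  [seq act_box p (tagged z) | p : 'S_(tag z).1].

(* Sum over the group, on RT(r) (x) RT^[x]r.                                  *)
Definition trace : {malg K[box]} -> {malg K[box]} :=
  linext (fun z : box => \sum_(p : 'S_(tag z).1) << act_box p (tagged z) >>).

(* The inverse of the trace, from the invariants to the coinvariants, the     *)
(* latter being represented by the combinations of the chosen elements of the *)
(* orbits (choose only depends on the orbit).  The group acts freely on the   *)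
(* elements with non-empty blocks, whence traceK below.                       *)
Definition trace_inv (v : {malg K[box]}) : {malg K[box]} :=
  \sum_(z <- msupp v | choose (mem (orbit_box z)) z == z) v@_z *: << z >>.

Lemma act_box_comp r n (p p' : 'S_r) (z : box_at r n) :
  act_box p' (tagged (act_box p z)) = act_box (p * p')%g z.
Proof.
case: z => [[t [b q]] x]; rewrite /act_box /=.
congr (Box (_, (_, _), _)).
  apply/val_inj/ffunP=> i /=; rewrite !ffunE invMg permM.
  by case: (parent _ _) => //= j; rewrite permM.
by apply/ffunP=> i; rewrite !ffunE permM.
Qed.

Lemma act_box1 r n (z : box_at r n) : act_box 1%g z = Box z.
Proof.
case: z => [[t [b q]] x]; rewrite /act_box.
congr (Box (_, (_, _), _)).
  apply/val_inj/ffunP=> i /=; rewrite !ffunE invg1 perm1.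
  by case: (parent _ _) => //= j; rewrite perm1.
by apply/ffunP=> i; rewrite !ffunE perm1.
Qed.

(* No block is empty: this holds for trees, as RT(0) = 0.                     *)
Definition full_blocks (z : box) : Prop :=
  forall k, exists i, (tagged z).1.2.1 i = k.

Lemma act_box_inj r n (z : box_at r n) : full_blocks (Box z) ->
  injective (fun p : 'S_r => act_box p z).
Proof.
case: z => [[t [b q]] x] fz p p' E; apply/permP=> k.
have [i /= bi] := fz k.
have E2 :
  tagged (act_box p (t, (b, q), x)) = tagged (act_box p' (t, (b, q), x)).
  by apply/eqP; rewrite -eq_Tagged; apply/eqP.
by move: (congr1 (fun z : box_at r n => z.1.2.1 i) E2); rewrite /= !ffunE bi.
Qed.

Lemma choose_orbit_box (z : box) (p : 'S_(tag z).1) :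
  choose (mem (orbit_box (act_box p (tagged z)))) (act_box p (tagged z)) =
  choose (mem (orbit_box z)) z.
Proof.
case: z p => [[r n] z] p /=; rewrite /orbit_box /=.
have E : mem [seq act_box p' (tagged (act_box p z)) | p' : 'S_r]
         =i mem [seq act_box p' z | p' : 'S_r].
  move=> y; apply/imageP/imageP => -[p' _ ->].
    by exists (p * p')%g; rewrite // act_box_comp.
  by exists (p^-1 * p')%g; rewrite // act_box_comp mulKVg.
rewrite (eq_choose (Q := mem [seq act_box p' z | p' : 'S_r])); last first.
  by move=> y; apply: E.
apply: choose_id; first by apply/imageP; exists p.
by apply/imageP; exists 1%g; rewrite ?act_box1.
Qed.

Lemma traceK (v : {malg K[box]}) :
  (forall r n (p : 'S_r) (z : box_at r n), v@_(act_box p z) = v@_(Box z)) ->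
  {in msupp v, forall z, full_blocks z} ->
  trace (trace_inv v) = v.
Proof.
move=> inv full; apply/malgP=> c.
pose rep z := choose (mem (orbit_box z)) z.
have wE z : (trace_inv v)@_z = v@_z *+ (rep z == z).
  rewrite raddf_sum /=.
  under eq_bigr => y _ do rewrite mcoeffZ mcoeffU.
  have [zv|zv] := boolP (z \in msupp v); last first.
    rewrite (mcoeff_outdom zv) mul0rn big_seq_cond big1 // => y /andP[yv _].
    by case: eqP => [yz|_]; rewrite ?mulr0 // -yz yv in zv *.
  rewrite big_mkcond /= (bigD1_seq z) ?fset_uniq //= eqxx mulr1 big1 ?addr0.
    by rewrite -/(rep z); case: eqP.
  by move=> y yz; rewrite (negbTE yz) mulr0 if_same.
have supp : {subset msupp (trace_inv v) <= msupp v}.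
  move=> z; rewrite -!mcoeff_neq0 wE; apply: contraNN => /eqP->.
  by rewrite mul0rn.
have vact z (p : 'S_(tag z).1) : v@_(act_box p (tagged z)) = v@_z.
  by case: z p => [[r n] z] p; rewrite inv.
rewrite /trace linext_coeff.
have cE z : z \in msupp (trace_inv v) ->
    (\sum_(p : 'S_(tag z).1) << act_box p (tagged z) >> : {malg K[box]})@_c =
    (z == rep c)%:R *+ (c \in msupp v).
  move=> zw; have zv := supp _ zw.
  have rz : rep z = z.
    move: zw; rewrite -mcoeff_neq0 wE; case: (rep z =P z) => // _.
    by rewrite mulr0n eqxx.
  rewrite raddf_sum /=; under eq_bigr => p _ do rewrite mcoeffU.
  have [cv|cv] := boolP (c \in msupp v); last first.
    rewrite mulr0n big1 // => p _; case: eqP => // pc.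
    by move: zv cv; rewrite -!mcoeff_neq0 -pc vact => ->.
  rewrite mulr1n; have [zc|zc] := eqVneq z (rep c); last first.
    rewrite big1 // => p _; case: eqP => // pc.
    by rewrite -pc /rep choose_orbit_box -/(rep z) rz eqxx in zc.
  have [p pc] : exists p : 'S_(tag z).1, act_box p (tagged z) = c.
    have : rep c \in mem (orbit_box c).
      apply: chooseP; apply/imageP; exists 1%g => //.
      by case: (c) => [[r n] c']; rewrite act_box1.
    rewrite -zc => /imageP[p _ E]; rewrite E.
    clear; case: c p => [[r n] c] p /=; exists (p^-1)%g.
    by rewrite act_box_comp mulgV act_box1.
  rewrite (bigD1 p) //= pc eqxx big1 ?addr0 // => p' p'p.
  case: eqP => // p'c; case/eqP: p'p.
  have := full _ zv; move: p p' pc p'c; clear.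
  case: z => [[r n] z] /= p p' pc p'c fz.
  by apply: (act_box_inj fz); rewrite pc p'c.
rewrite big_seq (eq_bigr _ (fun z zw => congr1 _ (cE z zw))) -big_seq.
have [cv|cv] := boolP (c \in msupp v); last first.
  by rewrite (mcoeff_outdom cv) big1 // => z _; rewrite mulr0n mulr0.
have rc : v@_(rep c) = v@_c /\ rep (rep c) = rep c.
  have : rep c \in mem (orbit_box c).
    apply: chooseP; apply/imageP; exists 1%g => //.
    by case: (c) => [[r n] c']; rewrite act_box1.
  by case/imageP=> p _ E; rewrite E vact /rep choose_orbit_box -/(rep c) -E.
have rw : rep c \in msupp (trace_inv v).
  by rewrite -mcoeff_neq0 wE rc.2 eqxx mulr1n rc.1 mcoeff_neq0.
rewrite (bigD1_seq (rep c)) ?fset_uniq //= big1 ?addr0 => [|z zc].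
  by rewrite wE rc.2 rc.1 !eqxx !mulr1n mulr1.
by rewrite (negbTE zc) mul0rn mulr0.
Qed.

(* ------------------------------------------------------------------------ *)

(* Trees whose vertices are labelled by a subset of L: the set of vertices    *)
(* and the parent map.                                                        *)
Definition ltree (L : finType) : choiceType :=
  ({set L} * parent_map L)%type.

(* In(tau, i), an edge being identified with its source.                      *)
Definition In_edges (L : finType) (t : ltree L) (i : L) : {set L} :=
  [set j | t.2 j == Some i].

Definition circ_at (L : finType) (t : ltree L) (i : L) (u : ltree L)
    (f : {ffun L -> L}) : ltree L :=
  (t.1 :\ i :|: u.1,
   [ffun j => if j \in u.1 then
                if u.2 j is Some k then Some k else t.2 i
              else if j \in t.1 :\ i then
                if j \in In_edges t i then Some (f j) else t.2 j
              else None]).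

(* tau o_i upsilon, for upsilon labelled by labels that are not used in tau   *)
(* (so that no shift is needed).  A map f from In(tau, i) to the vertices of  *)
(* upsilon is extended by the value i.                                        *)
Definition circ (L : finType) (t : ltree L) (i : L) (u : ltree L) :
    {malg K[ltree L]} :=
  \sum_(f in pffun_on i (mem (In_edges t i)) (mem u.1)) << circ_at t i u f >>.

Lemma is_rtree_circ_at (L : finType) (t u : ltree L) (i : L)
    (f : {ffun L -> L}) :
  is_rtree t.1 t.2 -> is_rtree u.1 u.2 -> i \in t.1 -> [disjoint t.1 & u.1] ->
  f \in pffun_on i (mem (In_edges t i)) (mem u.1) ->
  is_rtree (circ_at t i u f).1 (circ_at t i u f).2.
Proof.
move=> /andP[/exists_inP[r rt /andP[/eqP pr /forall_inP cr]] /forallP st].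
move=> /andP[/exists_inP[o ou /andP[/eqP po /forall_inP co]] /forallP su].
move=> it dis.
move=> /pffun_onP[_ fu].
have tNu j : j \in t.1 -> j \in u.1 = false by apply: disjointFr.
have inT a b : t.2 a = Some b -> a \in t.1.
  by move=> ab; apply: contraTT (st a) => na; rewrite negb_imply na ab.
have inU a b : u.2 a = Some b -> a \in u.1.
  by move=> ab; apply: contraTT (su a) => na; rewrite negb_imply na ab.
set q := (circ_at t i u f).2; set e := [rel a b | q a == Some b].
have cu j : j \in u.1 -> connect e j o.
  move=> /co; apply: connect_sub => a b /= /eqP ab; apply: connect1.
  by rewrite /= ffunE (inU _ _ ab) ab.
pose h j := if j == i then o else j.
have ch a b : t.2 a = Some b -> connect e (h a) (h b).
  move=> ab; rewrite /h; have aT := inT _ _ ab.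
  have [ai | ai] := eqVneq a i; have [bi | bi] := eqVneq b i.
  - exact: connect0.
  - by apply: connect1; rewrite /= ffunE ou po -ai ab.
  - have aI : a \in In_edges t i by rewrite inE ab bi.
    have fa : f a \in u.1 by apply: fu; apply: image_f.
    apply: connect_trans (cu _ fa); apply: connect1.
    by rewrite /= ffunE tNu // !inE ai aT ab bi eqxx.
  - apply: connect1.
    rewrite /= ffunE tNu // !inE ai aT ab /=.
    by rewrite [Some b == Some i](negbTE bi).
have cth j : j \in t.1 -> connect e (h j) (h r).
  move=> /cr /connectP[s]; elim: s j => [|k s IH] j /=.
    by move=> _ ->; apply: connect0.
  by case/andP=> /eqP /ch jk sk /(IH _ sk); apply: connect_trans.
have hi : h i = o by rewrite /h eqxx.
apply/andP; split.
  apply/exists_inP; exists (h r).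
    rewrite /h; have [_ | ri] := eqVneq r i; first by rewrite !inE ou orbT.
    by rewrite !inE ri rt.
  apply/andP; split.
    rewrite /h /= ffunE; have [ri | ri] := eqVneq r i.
      by rewrite ou po -ri pr.
    by rewrite tNu // !inE ri rt /= pr.
  apply/forall_inP=> j; rewrite !inE => /orP[/andP[ji jt]|ju].
    by have := cth _ jt; rewrite {1}/h (negbTE ji).
  by apply: connect_trans (cu _ ju) _; rewrite -hi; apply: cth.
apply/forallP=> j; apply/implyP; rewrite !inE negb_or => /andP[jt ju].
by rewrite ffunE (negbTE ju) !inE (negbTE jt).
Qed.

Section Compose.

Variables (r n : nat).

Definition outer_ltree (t : rtree r) : ltree ('I_r + 'I_n)%type :=
  ([set inl k | k : 'I_r],
   [ffun l => if l is inl k then omap inl (parent t k) else None]).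

Definition block_ltree (b : {ffun 'I_n -> 'I_r}) (q : parent_map 'I_n)
    (k : 'I_r) : ltree ('I_r + 'I_n)%type :=
  ([set inr i | i : 'I_n & b i == k],
   [ffun l => if l is inr i then
                if b i == k then omap inr (q i) else None
              else None]).

(* The composition of upsilon with the trees tau_k on the blocks, as iterated *)
(* partial compositions.                                                      *)
Definition compose_ltree (t : rtree r) (b : {ffun 'I_n -> 'I_r})
    (q : parent_map 'I_n) : {malg K[ltree ('I_r + 'I_n)%type]} :=
  foldl (fun v k => linext (fun t' => circ t' (inl k) (block_ltree b q k)) v)
    << outer_ltree t >> (enum 'I_r).

Definition to_parent_map (t : ltree ('I_r + 'I_n)%type) : parent_map 'I_n :=
  [ffun i => if t.2 (inr i) is Some (inr j) then Some j else None].

(* When q defines a tree on each block, compose_ltree t b q is a combination  *)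
(* of trees (by is_rtree_circ_at) with set of vertices {inr i | i : 'I_n}, so *)
(* that the default value 0 is not used.                                      *)
Definition compose_at (z : box_at r n) : {malg K[dtree X]} :=
  let: (t, (b, q), x) := z in
  linext (fun t' => if insub (to_parent_map t') is Some t''
                    then << DTree (t'' : rtree n) x >> else 0)
    (compose_ltree t b q).

End Compose.

(* The monad multiplication Gamma(RT, Gamma(RT, V)) -> Gamma(RT, V).          *)
Definition mu (v : {malg K[dtree (dtree X)]}) : {malg K[dtree X]} :=
  linext (fun z : box => compose_at (tagged z)) (trace_inv (linext spread v)).

End Gamma.

Arguments orbit_sum K {X} u.

(* ------------------------------------------------------------------------ *)

(* Corolla x [:: M_1; ...; M_r] is O F_r(x, M_1, ..., M_r).                   *)
Inductive monomial (X : Type) := Corolla of X & seq (monomial X).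

Section NormalForm.

Variables (K : comNzRingType) (X : choiceType).

Fixpoint ev (M : monomial X) : {malg K[dtree X]} :=
  let: Corolla x Ms := M in
  mu (orbit_sum2
        (corolla_dtree (orbit_sum K (corolla_dtree x [::])) (map ev Ms))).

Definition normal_form (t : dtree X) (M : monomial X) : Prop :=
  ev M = orbit_sum K t.

End NormalForm.

(* Equality up to permutation of the non-root entries of the corollas.        *)
Inductive eq_upto_perm (X : Type) : monomial X -> monomial X -> Prop :=
| EqRefl M : eq_upto_perm M M
| EqTrans M N P : eq_upto_perm M N -> eq_upto_perm N P -> eq_upto_perm M P
| EqSwap x s1 M N s2 :
    eq_upto_perm (Corolla x (s1 ++ M :: N :: s2))
                 (Corolla x (s1 ++ N :: M :: s2))
| EqEntry x s1 M N s2 :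
    eq_upto_perm M N ->
    eq_upto_perm (Corolla x (s1 ++ M :: s2)) (Corolla x (s1 ++ N :: s2)).

(* Main.v *)
Require Import Defs.
From mathcomp Require Import all_boot all_order all_algebra.
From mathcomp Require Import all_fingroup finmap monalg.

Set Implicit Arguments.
Unset Strict Implicit.
Unset Printing Implicit Defensive.

Import GRing.Theory.

(** A plane monomial [M] describes a decorated rooted tree once the order of
    the non-root entries of its corollas is forgotten.  [reads M i] says that
    the subtree at the vertex [i] is the tree described by [M]: for some
    ordering of the children of [i], they read the entries of [M].  The
    key is [ev_coeff]:

      the coefficient of [ev M] at a decorated [n]-tree [u] is 1 if the root of
      [u] reads [M], and 0 otherwise.

    Granted this, two properties of readings conclude.  Firstly, a tree reads
    some [M], and it reads only the monomials equivalent to [M] ([dreads_inj]).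
    Secondly, the trees that read the same [M] as [t] are those of the orbit of
    [t] ([mem_orbit_dtree]), an isomorphism being built from the root upwards.
    Hence [ev M] is the orbit sum of [t] when [t] reads [M]; and if [ev N] is
    that orbit sum, its coefficient at [t] is 1, which is not 0, so that [t]
    reads [N] too.

    The formula for [ev M] is proved by induction on [M = F_r(x, M_1, .., M_r)].
    The composition involves no choice, because the root entry of the corolla is
    a single vertex, to which all the edges entering the root must be attached
    ([compose_star]).  It therefore suffices to count, for a given [u], the
    orbits under the symmetric group of the terms which compose to [u].  Such a
    term is a partition of the vertices of [u] into blocks, labelled by the
    vertices of the corolla, with a tree on every block; it has coefficient 1
    when every block carries a tree reading the corresponding entry, and 0
    otherwise ([spread_branches], [branches_spread]).  If it composes to [u],
    its blocks are the root of [u] and the branches of [u], so that [u] reads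
    [M] ([branches_reads]).  Conversely, if [u] reads [M], cutting the edges
    entering its root gives such a term ([branches_exist]), and the only freedom
    left is the labelling of the blocks, so that there is exactly one orbit
    ([branches_orbit]).  Since the inverse of the trace counts orbits, and not
    their elements, the coefficient is exactly 1 over any ring, whatever the
    automorphisms of the tree. *)

(** * Decorated trees read as monomials *)

(** The induction principle generated for [monomial] says nothing about the
    entries of a corolla, which occur under [seq]. *)
Lemma monomial_nth_ind (X : Type) (P : monomial X -> Prop) :
  (forall a Ms, (forall d k, k < size Ms -> P (nth d Ms k)) ->
     P (Corolla a Ms)) ->
  forall M, P M.
Proof.
move=> IH; fix rec 1; case=> a Ms; apply: IH => d.
elim: Ms => [k|M Ms IHs [_|k]]; last exact (IHs k); last exact (rec M).
by clear rec; rewrite ltn0.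
Qed.

Lemma eq_upto_perm_move (X : Type) (a : X) pre (M : monomial X) s1 s2 :
  eq_upto_perm (Corolla a (pre ++ M :: s1 ++ s2))
               (Corolla a (pre ++ s1 ++ M :: s2)).
Proof.
elim: s1 pre => [|N s1 IH] pre; first exact: EqRefl.
apply: EqTrans (EqSwap _ _ _ _ _) _.
by move: (IH (rcons pre N)); rewrite !cat_rcons.
Qed.

Lemma eq_upto_perm_sym (X : Type) (M N : monomial X) :
  eq_upto_perm M N -> eq_upto_perm N M.
Proof.
elim=> [P|P Q R _ IH1 _ IH2|a s1 P Q s2|a s1 P Q s2 _ IH].
- exact: EqRefl.
- exact: EqTrans IH2 IH1.
- exact: EqSwap.
- exact: EqEntry.
Qed.

Lemma all2_split (S T : Type) (e : S -> T -> bool) s t1 y t2 :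
  all2 e s (t1 ++ y :: t2) ->
  exists s1 z s2, [/\ s = s1 ++ z :: s2, all2 e s1 t1, e z y & all2 e s2 t2].
Proof.
elim: t1 s => [|u t1 IH] [|z s] //=.
  by case/andP=> zy st; exists [::], z, s.
case/andP=> zu /IH[s1 [w [s2 [-> s1t1 wy s2t2]]]].
by exists (z :: s1), w, s2; rewrite /= zu.
Qed.

Lemma all2C (S T : Type) (e : S -> T -> bool) s t :
  all2 e s t = all2 (fun y x => e x y) t s.
Proof. by elim: s t => [|x s IH] [|y t] //=; rewrite IH. Qed.

Lemma all2_cat (S T : Type) (e : S -> T -> bool) s1 s2 t1 t2 :
  all2 e s1 t1 -> all2 e s2 t2 -> all2 e (s1 ++ s2) (t1 ++ t2).
Proof. by elim: s1 t1 => [|x s1 IH] [|y t1] //= /andP[-> /IH]. Qed.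

Lemma all2_from_nth (S T : Type) (e : S -> T -> bool) x0 y0 s t :
  size s = size t ->
  (forall k, (k < size s)%N -> e (nth x0 s k) (nth y0 t k)) -> all2 e s t.
Proof.
elim: s t => [|x s IH] [|y t] //= [st] H; apply/andP; split; first exact: (H 0).
by apply: IH => // k; apply: (H k.+1).
Qed.

Lemma all2_to_nth (S T : Type) (e : S -> T -> bool) x0 y0 s t :
  all2 e s t ->
  size s = size t /\
  forall k, (k < size s)%N -> e (nth x0 s k) (nth y0 t k).
Proof.
elim: s t => [|x s IH] [|y t] //= /andP[xy /IH[-> H]]; split=> //.
by case.
Qed.

Section Reads.

Variables (X : choiceType) (T : finType) (p : T -> option T) (x : T -> X).

Definition children (i : T) : seq T := [seq j <- enum T | p j == Some i].

(** The ordering of the children ranges over tuples so that the predicate is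
    boolean; it is then also the value, 0 or 1, of a coefficient. *)
Fixpoint reads (M : monomial X) (i : T) : bool :=
  let: Corolla a Ms := M in
  (x i == a) &&
  [exists js : (size Ms).-tuple T, perm_eq js (children i) && all2 reads Ms js].

Lemma mem_children i j : (j \in children i) = (p j == Some i).
Proof. by rewrite mem_filter mem_enum andbT. Qed.

Lemma children_uniq i : uniq (children i).
Proof. by rewrite filter_uniq ?enum_uniq. Qed.

Lemma readsP a Ms i :
  reflect (x i = a /\ exists2 js, perm_eq js (children i) & all2 reads Ms js)
          (reads (Corolla a Ms) i).
Proof.
apply: (iffP andP) => [[/eqP -> /existsP[js /andP[js_ch Mjs]]]|].
  by split=> //; exists js.
move=> [-> [js js_ch Mjs]]; split; first exact: eqxx.
have js_size : size js == size Ms by move: Mjs; rewrite all2E eq_sym => /andP[].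
by apply/existsP; exists (Tuple js_size); apply/andP.
Qed.

Lemma eq_upto_perm_reads M N i : eq_upto_perm M N -> reads M i = reads N i.
Proof.
have sub M' N' : eq_upto_perm M' N' -> forall j, reads M' j -> reads N' j.
  elim=> {M' N'} [M'|M' N' P' _ IH1 _ IH2|a s1 M' N' s2|a s1 M' N' s2 _ IH] j.
  - exact: id.
  - by move/IH1/IH2.
  - case/readsP=> xj [js js_ch]; rewrite all2C.
    move=> Mjs; have [l1 [k1 [l1' [jsE e1 e2 e2']]]] := all2_split Mjs.
    case: l1' jsE e2' => [//|k2 l2] jsE /= /andP[e3 e4]; apply/readsP;
      split=> //.
    exists (l1 ++ k2 :: k1 :: l2); last first.
      by rewrite all2C all2_cat //= e3 e2.
    apply: perm_trans js_ch; rewrite jsE perm_cat2l.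
    exact: (permEl (perm_catCA [:: k2] [:: k1] l2)).
  - case/readsP=> xj [js js_ch]; rewrite all2C.
    move=> Mjs; have [l1 [k1 [l2 [js_def e1 e2 e3]]]] := all2_split Mjs.
    apply/readsP; split=> //; exists js => //.
    by rewrite all2C js_def all2_cat //= e3 IH.
by move=> MN; apply/idP/idP; apply: sub => //; apply: eq_upto_perm_sym.
Qed.

(** A vertex determines the monomial up to the orderings chosen for the children
    at each level: matching the two orderings at the top level leaves pairs of
    entries read by the same child. *)
Lemma reads_inj M N i : reads M i -> reads N i -> eq_upto_perm M N.
Proof.
elim/monomial_nth_ind: M N i => a Ms IH [b Ns] i.
case/readsP=> <- [js js_ch Mjs] /readsP[<- [js' js'_ch Njs']].
have : perm_eq js js' by apply: perm_trans js_ch _; rewrite perm_sym.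
rewrite -[Ms]/([::] ++ Ms) -[Ns]/([::] ++ Ns).
elim: Ms IH js js' Mjs Ns Njs' [::] {js_ch js'_ch} =>
  [|M Ms IHs] IH [|j js] //= js'.
  move=> _ Ns Njs' pre /perm_size/esym/size0nil js'0.
  by move: Njs'; rewrite js'0; case: Ns => // _; apply: EqRefl.
case/andP=> Mj Mjs Ns Njs' pre js_js'.
have /splitPr js'E : j \in js' by rewrite -(perm_mem js_js') mem_head.
case: js'E js_js' Njs' => l1 l2 js_js'.
move=> Njs'; have [N1 [N [N2 [-> e1 e2 e3]]]] := all2_split Njs'.
(* [N] is the entry of the second monomial read by the child [j]: replace [M]
   by [N], treat the other entries, then bring [N] to its place. *)
apply: EqTrans (EqEntry _ _ _ (IH M 0 _ _ _ Mj e2)) _ => //.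
rewrite -cat_rcons.
apply: (@EqTrans _ _ (Corolla (x i) (rcons pre N ++ N1 ++ N2))).
  apply: (IHs (fun d k => IH d k.+1) js (l1 ++ l2)) (all2_cat e1 e3) _ _ => //.
  rewrite -(perm_cons j) (perm_trans js_js') //.
  exact: (permEl (perm_catCA l1 [:: j] l2)).
by rewrite cat_rcons; apply: eq_upto_perm_move.
Qed.

End Reads.

Lemma perm_eq_mapP (T1 T2 : eqType) (f : T1 -> T2) s t :
  perm_eq s (map f t) -> exists2 s', s = map f s' & perm_eq s' t.
Proof.
case: t => [/perm_size/size0nil -> | y t]; first by exists [::].
case/(perm_iotaP (f y))=> Is; rewrite size_map => IsP ->.
exists (map (nth y (y :: t)) Is); last by apply/(perm_iotaP y); exists Is.
rewrite -map_comp; apply/eq_in_map => k; rewrite (perm_mem IsP) mem_iota => kt.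
exact: (nth_map y (f y) f kt).
Qed.

Lemma all2_map_r (S T1 T2 : Type) (e : S -> T2 -> bool) (f : T1 -> T2) s t :
  all2 e s (map f t) = all2 (fun x y => e x (f y)) s t.
Proof. by elim: s t => [|x s IH] [|y t] //=; rewrite IH. Qed.

(** A reading only looks at descendants, so it can be computed in any
    parent-preserving copy which contains all the children of the vertices of
    the copy: a relabelled tree, or a branch embedded in the tree. *)
Lemma reads_transport (X : choiceType) (T T' : finType)
    (p : T -> option T) (x : T -> X) (p' : T' -> option T') (x' : T' -> X)
    (f : T' -> T) :
  injective f -> (forall j, x (f j) = x' j) ->
  (forall c j, p c = Some (f j) <-> exists2 c', c = f c' & p' c' = Some j) ->
  forall M j, reads p x M (f j) = reads p' x' M j.
Proof.
move=> f_inj xf pf; elim/monomial_nth_ind=> a Ms IH j.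
have ch : perm_eq (children p (f j)) (map f (children p' j)).
  apply: uniq_perm; rewrite ?map_inj_uniq ?children_uniq // => c.
  rewrite mem_children; apply/eqP/mapP => [/pf[c' -> c'j]|[c' c'j ->]].
    by exists c'; rewrite // mem_children c'j.
  by apply/pf; exists c' => //; apply/eqP; rewrite -mem_children.
have all2E js : all2 (reads p x) Ms (map f js) = all2 (reads p' x') Ms js.
  rewrite all2_map_r; elim: Ms IH js {ch} => [|M Ms IHs] IH [|k js] //=.
  by rewrite (IH M 0) // (IHs (fun d k => IH d k.+1)).
apply/readsP/readsP; rewrite xf => -[-> [js js_ch Mjs]]; split=> //.
  have [js' js'E js'_ch] := perm_eq_mapP (perm_trans js_ch ch).
  by exists js'; rewrite // -all2E -js'E.
exists (map f js); last by rewrite all2E.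
by apply: perm_trans (perm_map f js_ch) _; rewrite perm_sym.
Qed.

(** * Isomorphism of trees with the same reading *)

(** Being a rooted tree amounts to having one root and a depth function; unlike
    connectedness, this supports inductions away from the root. *)
Definition grading (T : Type) (p : T -> option T) (r : T) (dep : T -> nat) :=
  [/\ p r = None, forall i, p i = None -> i = r
    & forall i j, p i = Some j -> dep i = (dep j).+1].

(** The depth is the length of the path to the root; it is unique because the
    path stops at the root, which has no parent. *)
Lemma rtree_grading (T : finType) (p : parent_map T) :
  is_rtree [set: T] p -> exists r dep, grading p r dep.
Proof.
case/andP=> /exists_inP[r _ /andP[/eqP pr /forall_inP cr]] _.
pose up k i := iter k (obind p) (Some i).
have upS k i : up k.+1 i = if p i is Some j then up k j else None.
  by rewrite /up iterSr /=; case: (p i) => //=; elim: k => //= k ->.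
have ex_dep i : exists k, up k i == Some r.
  have /connectP[q] := cr i (in_setT i).
  elim: q i => [|j q IH] i /=; first by move=> _ ->; exists 0; rewrite /up.
  by case/andP=> /eqP ij qP /(IH _ qP)[k upk]; exists k.+1; rewrite upS ij.
have [dep depP] := fin_all_exists ex_dep.
have up_inj k i k' : up k i = Some r -> up k' i = Some r -> k = k'.
  elim: k i k' => [|k IH] i [|k'] //; rewrite ?upS.
  - by rewrite /up /= => -[->]; rewrite pr.
  - by move=> + [ir]; rewrite ir pr.
  - by case: (p i) => // j upk upk'; rewrite (IH _ _ upk upk').
exists r, dep; split=> // [i pi | i j pij].
  by have := depP i; case: (dep i) => [|k]; [move/eqP=> [] | rewrite upS pi].
by apply: (@up_inj _ i); [exact/eqP | rewrite upS pij; exact/eqP].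
Qed.

Lemma grading_rtree (T : finType) (p : parent_map T) r dep :
  grading p r dep -> is_rtree [set: T] p.
Proof.
case=> pr rP depP; apply/andP; split; last by apply/forallP=> i;
  rewrite in_setT.
apply/exists_inP; exists r; rewrite ?in_setT // pr eqxx /=.
apply/forall_inP=> i _; elim: (dep i) {-2}i (erefl (dep i)) => [|k IH] {}i di.
  case pi: (p i) => [j|]; first by rewrite (depP _ _ pi) in di.
  by rewrite (rP _ pi) connect0.
case pi: (p i) => [j|]; last by rewrite (rP _ pi) connect0.
apply: connect_trans (connect1 _) (IH j _); first exact/eqP.
by apply/succn_inj; rewrite -(depP _ _ pi).
Qed.

(** Recursion from the root upwards; the depth of the vertex is the fuel. *)
Lemma top_down (T A : Type) (p : T -> option T) (dep : T -> nat)
    (init : T -> A) (step : T -> T -> A -> A) :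
  (forall i j, p i = Some j -> dep i = (dep j).+1) ->
  exists F : T -> A,
    forall i, F i = if p i is Some j then step i j (F j) else init i.
Proof.
move=> depP; pose fix rec (n : nat) (i : T) {struct n} : A :=
  if n is n'.+1 then if p i is Some j then step i j (rec n' j) else init i
  else init i.
exists (fun i => rec (dep i).+1 i) => i /=.
by case pi: (p i) => [j|] //; rewrite (depP _ _ pi).
Qed.

Section Readings.

Variables (X : choiceType) (T : finType) (p : T -> option T) (x : T -> X).

Lemma reads_exists (dep : T -> nat) :
  (forall i j, p i = Some j -> dep i = (dep j).+1) ->
  forall i, exists M, reads p x M i.
Proof.
move=> depP i; pose N := \max_j dep j.
(* Children are deeper, so [N - dep i] bounds the height of the
   subtree at [i]. *)
elim: {i}(N - dep i) {-2}i (leqnn (N - dep i)) => [|k IH] i iN.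
  exists (Corolla (x i) [::]); apply/readsP; split=> //; exists [::] => //.
  case chE: (children p i) => [//|c cs].
  have: c \in children p i by rewrite chE mem_head.
  rewrite mem_children => /eqP/depP ci; move: iN.
  by rewrite leqn0 subn_eq0 leqNgt -ci /N (leq_bigmax c).
suff [Ms Mjs] : exists Ms, all2 (reads p x) Ms (children p i).
  by exists (Corolla (x i) Ms); apply/readsP; split=> //; exists (children p i).
have : {subset children p i <= children p i} by [].
elim: {1 3}(children p i) => [|c cs IHc] csP; first by exists [::].
have [|Ms Mcs] := IHc; first by move=> c' c'P; apply: csP; rewrite inE c'P orbT.
have := csP c (mem_head _ _); rewrite mem_children => /eqP/depP ci.
have [|M Mc] := IH c; last by exists (M :: Ms); rewrite /= Mc.
by rewrite ci subnS; move: iN; case: (N - dep i).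
Qed.

Definition branch_of (M : monomial X) (k : nat) : monomial X :=
  let: Corolla _ Ms := M in nth M Ms k.

Definition order_of (M : monomial X) (i : T) : seq T :=
  let: Corolla _ Ms := M in
  if [pick js : (size Ms).-tuple T |
        perm_eq js (children p i) && all2 (reads p x) Ms js] is Some js
  then js else [::].

Lemma order_ofP M i : reads p x M i ->
  perm_eq (order_of M i) (children p i) /\
  (forall k, k < size (order_of M i) ->
     reads p x (branch_of M k) (nth i (order_of M i) k)).
Proof.
case: M => a Ms /=; case/readsP=> _ [js0 js0_ch Mjs0].
case: pickP => [js /andP[js_ch Mjs] | no_js].
  split=> // k; have [sz Mjs_nth] := all2_to_nth (Corolla a Ms) i Mjs.
  by rewrite -sz; apply: Mjs_nth.
have js0_size : size js0 == size Ms.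
  by move: Mjs0; rewrite all2E eq_sym => /andP[].
by have := no_js (Tuple js0_size); rewrite /= js0_ch Mjs0.
Qed.

End Readings.

Lemma reads_same_shape (X : choiceType) (M : monomial X) (T T' : finType)
    (p : T -> option T) (x : T -> X) (p' : T' -> option T') (x' : T' -> X)
    i i' :
  reads p x M i -> reads p' x' M i' ->
  x i = x' i' /\ size (order_of p x M i) = size (order_of p' x' M i').
Proof.
move=> Mi Mi'; have [js_ch _] := order_ofP Mi; have [js'_ch _] := order_ofP Mi'.
rewrite (perm_size js_ch) (perm_size js'_ch).
case: M Mi Mi' {js_ch js'_ch} => a Ms.
case/readsP=> -> [js js_ch Mjs] /readsP[-> [js' js'_ch Mjs']]; split=> //.
rewrite -(perm_size js_ch) -(perm_size js'_ch).
by move: Mjs Mjs'; rewrite !all2E => /andP[/eqP <- _] /andP[/eqP].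
Qed.

(** The map sends the root to the root and then, along the parents, the [k]-th
    child in the ordering chosen by the reading in the source to the [k]-th one
    in the target.  The value at a vertex carries the monomial read there, which
    selects the orderings.  It is injective by induction on the depth, since it
    preserves parents and is injective on siblings. *)
Lemma reads_embedding (X : choiceType) (M : monomial X) (T T' : finType)
    (p : T -> option T) (x : T -> X) r dep
    (p' : T' -> option T') (x' : T' -> X) r' :
  grading p r dep -> p' r' = None ->
  reads p x M r -> reads p' x' M r' ->
  exists f : T -> T', [/\ injective f, forall i, x' (f i) = x i
                        & forall i, p' (f i) = omap f (p i)].
Proof.
case=> pr rP depP pr' Mr Mr'.
pose step i j (fj : T' * monomial X) :=
  let k := index i (order_of p x fj.2 j) in
  (nth fj.1 (order_of p' x' fj.2 fj.1) k, branch_of fj.2 k).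
have [F FE] := top_down (fun=> (r', M)) step depP.
pose f i := (F i).1.
have FP i : reads p x (F i).2 i /\ reads p' x' (F i).2 (f i).
  elim: (dep i) {-2}i (erefl (dep i)) => [|n IH] {}i di; last first.
    case pi: (p i) => [j|]; last by rewrite /f FE pi (rP _ pi).
    have [|Mj Mj'] := IH j; first by apply/succn_inj; rewrite -(depP _ _ pi).
    have [_ so] := reads_same_shape Mj Mj'.
    have [jo Mo] := order_ofP Mj; have [_ Mo'] := order_ofP Mj'.
    have io : i \in order_of p x (F j).2 j.
      by rewrite (perm_mem jo) mem_children pi.
    have ks : index i (order_of p x (F j).2 j) < size (order_of p x (F j).2 j).
      by rewrite index_mem.
    rewrite /f FE pi /=; split; last by apply: Mo'; rewrite -so.
    by have := Mo _ ks; rewrite nth_index.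
  case pi: (p i) => [j|]; first by rewrite (depP _ _ pi) in di.
  by rewrite /f FE pi (rP _ pi).
have fpar i : p' (f i) = omap f (p i).
  case pi: (p i) => [j|]; last by rewrite /f FE pi.
  have [Mj Mj'] := FP j; have [_ so] := reads_same_shape Mj Mj'.
  have [jo _] := order_ofP Mj; have [jo' _] := order_ofP Mj'.
  rewrite /f FE pi /=; apply/eqP; rewrite -mem_children -(perm_mem jo').
  by rewrite mem_nth // -so index_mem (perm_mem jo) mem_children pi.
exists f; split=> // [i1 i2|i]; last first.
  by have [Mi Mi'] := FP i; have [-> _] := reads_same_shape Mi Mi'.
elim: (dep i1) {-2}i1 (erefl (dep i1)) i2 => [|n IH] {}i1 di1 i2 f12.
  have : omap f (p i1) = omap f (p i2) by rewrite -!fpar f12.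
  case p1: (p i1) => [j|]; first by rewrite (depP _ _ p1) in di1.
  by case p2: (p i2) => //; rewrite (rP _ p1) (rP _ p2).
have : omap f (p i1) = omap f (p i2) by rewrite -!fpar f12.
case p1: (p i1) => [j1|]; last first.
  by case p2: (p i2) => //; rewrite (rP _ p1) (rP _ p2).
case p2: (p i2) => [j2|//] [] /IH j12.
have {j12} j12 : j1 = j2 by apply/j12/succn_inj; rewrite -(depP _ _ p1).
move: p1; rewrite {}j12 {j1} => p1; move: f12; rewrite /f !FE p1 p2 /=.
have [Mj Mj'] := FP j2; have [_ so] := reads_same_shape Mj Mj'.
have [jo _] := order_ofP Mj; have [jo' _] := order_ofP Mj'.
have i1o : i1 \in order_of p x (F j2).2 j2.
  by rewrite (perm_mem jo) mem_children p1.
have i2o : i2 \in order_of p x (F j2).2 j2.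
  by rewrite (perm_mem jo) mem_children p2.
move/eqP; rewrite nth_uniq -?so ?index_mem ?(perm_uniq jo') ?children_uniq //.
by move/eqP/(congr1 (nth i1 (order_of p x (F j2).2 j2))); rewrite !nth_index.
Qed.

Definition dparent (D : choiceType) (u : dtree D) := parent (tagged u).1.
Definition dlabel (D : choiceType) (u : dtree D) := tnth (tagged u).2.

Arguments dparent {D} u.
Arguments dlabel {D} u _.

Definition dreads (X : choiceType) (M : monomial X) (u : dtree X) : bool :=
  [exists i, (dparent u i == None) && reads (dparent u) (dlabel u) M i].

Lemma dtree_grading (D : choiceType) (u : dtree D) :
  exists r dep, grading (dparent u) r dep.
Proof. by apply: rtree_grading; rewrite /dparent; case: (tagged u).1. Qed.

Lemma dreads_exists (X : choiceType) (u : dtree X) : exists M, dreads M u.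
Proof.
have [r [dep [pr rP depP]]] := dtree_grading u.
have [M Mr] := reads_exists (dlabel u) depP r.
by exists M; apply/existsP; exists r; rewrite pr Mr.
Qed.

Lemma dreads_root (X : choiceType) (M : monomial X) (u : dtree X) r dep :
  grading (dparent u) r dep -> dreads M u = reads (dparent u) (dlabel u) M r.
Proof.
case=> pr rP _; apply/existsP/idP => [[i /andP[/eqP /rP -> //]]|Mr].
by exists r; rewrite pr Mr.
Qed.

Lemma dreads_inj (X : choiceType) (M N : monomial X) (u : dtree X) :
  dreads M u -> dreads N u -> eq_upto_perm M N.
Proof.
have [r [dep gr]] := dtree_grading u.
by rewrite !(dreads_root _ gr); apply: reads_inj.
Qed.

Lemma eq_upto_perm_dreads (X : choiceType) (M N : monomial X) (u : dtree X) :
  eq_upto_perm M N -> dreads M u = dreads N u.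
Proof.
move=> MN; apply: eq_existsb => i.
by rewrite (eq_upto_perm_reads _ _ _ MN).
Qed.

(** The orbit of a tree is its isomorphism class.  Embeddings in both
    directions force the same number of vertices, and then an embedding is a
    relabelling. *)
Lemma mem_orbit_dtree (X : choiceType) (M : monomial X) (u v : dtree X) :
  dreads M u -> (v \in orbit_dtree u) = dreads M v.
Proof.
move=> Mu; rewrite mem_undup; apply/imageP/idP => [[s _ ->]|Mv].
  have [i /andP[/eqP pi Mi]] := existsP Mu.
  apply/existsP; exists (s i).
  rewrite /dparent /dlabel /act_dtree /= ffunE permK.
  rewrite -/(dparent u) pi eqxx /=.
  rewrite (reads_transport (p' := dparent u) (x' := dlabel u)) //.
  - exact: perm_inj.
  - by move=> j; rewrite tnth_mktuple permK.
  move=> c j; rewrite ffunE -/(dparent u); split=> [|[c' -> E]]; last first.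
    by rewrite permK E.
  case E: (dparent u _) => [j'|] //= [/perm_inj jj'].
  by exists ((s^-1)%g c); rewrite ?permKV // E jj'.
have [r [dep gr]] := dtree_grading u; have [r' [dep' gr']] := dtree_grading v.
move: (Mu) (Mv); rewrite (dreads_root _ gr) (dreads_root _ gr') => Mr Mr'.
have [pr _ _] := gr; have [pr' _ _] := gr'.
have [f [f_inj fx fp]] := reads_embedding gr pr' Mr Mr'.
have [g [g_inj _ _]] := reads_embedding gr' pr Mr' Mr.
have uv : tag u = tag v.
  apply/eqP; rewrite eqn_leq -[tag u]card_ord -[tag v]card_ord.
  by rewrite (leq_card f) // (leq_card g).
case: u v uv f f_inj fx fp {Mu Mv gr gr' Mr Mr' pr pr' g g_inj dep dep' r r'}.
move=> n [t x] [n' [t' x']] /= nn'; case: n' / nn' t' x' => t' x' f f_inj.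
rewrite /dlabel /dparent /= => fx fp; exists (perm f_inj) => //.
congr DTree.
  apply/val_inj/ffunP=> i /=;
    rewrite ffunE -{1}(permKV (perm f_inj) i) permE fp.
  by case: (parent t _) => //= j; rewrite permE.
apply: eq_from_tnth => i; rewrite tnth_mktuple -fx -permE.
by rewrite (permKV (perm f_inj)).
Qed.

Local Open Scope ring_scope.

(** * Orbit sums of tensors *)

Lemma orbit_sum_coeff (K : comNzRingType) (X : choiceType) (M : monomial X)
    (u v : dtree X) :
  dreads M u -> (orbit_sum K u)@_v = (dreads M v)%:R.
Proof. by move=> Mu; rewrite orbit_sumE (mem_orbit_dtree _ Mu). Qed.

Lemma sum_neq0 (V : nmodType) (I : eqType) (s : seq I) (P : pred I)
    (F : I -> V) :
  \sum_(i <- s | P i) F i != 0 -> exists i, [/\ i \in s, P i & F i != 0].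
Proof.
have [/hasP[i si /andP[Pi Fi]] _|/hasPn noF] :=
  boolP (has (fun i => P i && (F i != 0)) s); first by exists i.
rewrite big_seq_cond big1 ?eqxx // => i /andP[/noF].
by case: (P i) => //=; case: eqP.
Qed.

Section Tensor.

Variables (K : comNzRingType) (X : choiceType) (r : nat).

Lemma tensor_shape (t : rtree r) (w : r.-tuple {malg K[dtree X]}) D :
  (tensor (DTree t w))@_D != 0 -> exists d, D = DTree t d.
Proof.
rewrite /tensor /= raddf_sum => /sum_neq0[d [_ _]].
rewrite /= mcoeffZ mcoeffU; case: (_ =P D) => [<- _|_];
  last by rewrite mulr0 eqxx.
by eexists.
Qed.

Lemma tensor_coeff (t t' : rtree r) (w : r.-tuple {malg K[dtree X]}) d' :
  (tensor (DTree t w))@_(DTree t' d') =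
  (t == t')%:R * \prod_(k < r) (tnth w k)@_(tnth d' k).
Proof.
rewrite /tensor /=; set S := (\bigcup_(k <- _) _)%fset.
have DTreeP d : (DTree t d == DTree t' d') = (t == t') && (d == d').
  by rewrite /DTree eq_Tagged.
rewrite raddf_sum /=; under eq_bigr => d _ do rewrite mcoeffZ mcoeffU DTreeP.
have [_|_] := eqVneq t t'; last first.
  by rewrite mul0r big1 // => d _; rewrite mulr0.
rewrite mul1r /=; case: (boolP [forall k, tnth d' k \in S]) => [/forallP dS|].
  pose d0 := [ffun k => [` dS k]%fset].
  have d0E : [tuple val (d0 k) | k < r] == d'.
    by apply/eqP/eq_from_tnth => k; rewrite tnth_mktuple ffunE.
  rewrite (bigD1 d0) //= d0E mulr1 [X in _ + X]big1 ?addr0 => [|d dd0].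
    by apply: eq_bigr => k _; rewrite ffunE.
  case: eqP => [dd'|]; last by rewrite mulr0.
  case/eqP: dd0; apply/ffunP => k; apply/val_inj.
  by rewrite ffunE /= -dd' tnth_mktuple.
rewrite negb_forall => /existsP[k0 k0S].
rewrite (bigD1 k0) //= mcoeff_outdom ?mul0r; last first.
  apply: contra k0S => k0w; apply/bigfcupP; exists k0; rewrite ?mem_enum //.
rewrite big1 // => d _; case: eqP => [dd'|]; last by rewrite mulr0.
by move: k0S; rewrite -dd' tnth_mktuple (valP (d k0)).
Qed.

(** From here on the coefficients of the entries are 0 or 1, and two entries
    having a common basis element in their supports are equal, as is the case of
    orbit sums.  Distinct elements of the orbit of [(t0, w)] then have disjoint
    supports, whence coefficients 0 or 1 again. *)
Variables (t0 : rtree r) (w : r.-tuple {malg K[dtree X]}).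
Variable supp : 'I_r -> dtree X -> bool.

Hypothesis w_coeff : forall k e, (tnth w k)@_e = (supp k e)%:R.
Hypothesis w_sep : forall k l e, supp k e -> supp l e -> tnth w k = tnth w l.

Lemma tensor_act_coeff (s : 'S_r) t' d' :
  (tensor (act_dtree s (t0, w)))@_(DTree t' d') =
  ((relabel s t0 == t') && [forall k, supp ((s^-1)%g k) (tnth d' k)])%:R.
Proof.
rewrite tensor_coeff /=; case: (_ == t'); rewrite ?mul0r // mul1r /=.
under eq_bigr => k _ do rewrite tnth_mktuple w_coeff.
case: forallP => [all_supp|].
  by rewrite big1 // => k _; rewrite all_supp.
move/forallP; rewrite negb_forall => /existsP[k /negbTE nk].
by rewrite (bigD1 k) //= nk mul0r.
Qed.

Lemma orbit_sum2_support D :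
  (orbit_sum2 (DTree t0 w))@_D != 0 ->
  exists (s : 'S_r) d, D = DTree (relabel s t0) d /\
    forall k, supp ((s^-1)%g k) (tnth d k).
Proof.
rewrite /orbit_sum2 raddf_sum => /sum_neq0[u' []] /=.
rewrite mem_undup => /imageP[s _ ->] /= _ uD.
have [d dE] := tensor_shape uD; move: uD; rewrite dE tensor_act_coeff eqxx /=.
by case: forallP => [sd _|]; rewrite ?eqxx //; exists s, d.
Qed.

Lemma orbit_sum2_coeff1 (s : 'S_r) d :
  (forall k, supp ((s^-1)%g k) (tnth d k)) ->
  (orbit_sum2 (DTree t0 w))@_(DTree (relabel s t0) d) = 1.
Proof.
move=> sd; rewrite /orbit_sum2 raddf_sum /=.
rewrite (bigD1_seq (act_dtree s (t0, w))) ?undup_uniq //=; last first.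
  by rewrite mem_undup; apply/imageP; exists s.
rewrite tensor_act_coeff eqxx (introT forallP sd) big_seq_cond big1 ?addr0 //.
move=> u' /andP[]; rewrite mem_undup => /imageP[s' _ ->] /= s's.
rewrite tensor_act_coeff; case: eqP => //= tt'; case: forallP => // s'd.
case/eqP: s's; rewrite /act_dtree /= tt'; congr DTree.
by apply: eq_from_tnth => k; rewrite !tnth_mktuple; apply: w_sep (s'd k) (sd k).
Qed.

End Tensor.

(** * Blocks and shuffles *)

Section Blocks.

Variables (X : choiceType) (r n : nat).

(** [f] identifies the tree [e] with the restriction of the forest [q] to the
    block of label [k], the vertices of the block being renumbered in increasing
    order. *)
Definition block_emb (b : {ffun 'I_n -> 'I_r}) (q : parent_map 'I_n)
    (x : n.-tuple X) (k : 'I_r) (e : dtree X) (f : 'I_(tag e) -> 'I_n) : Prop :=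
  [/\ {homo f : i j / (i < j)%N},
      forall i, b i = k <-> exists j, i = f j,
      forall j, q (f j) = omap f (dparent e j)
    & forall j, tnth x (f j) = dlabel e j].

Definition is_block b q x k (e : dtree X) :=
  exists f, block_emb b q x k (e := e) f.

Variables (b : {ffun 'I_n -> 'I_r}) (q : parent_map 'I_n) (x : n.-tuple X).
Variable k : 'I_r.

Lemma block_emb_inj (e : dtree X) f :
  block_emb b q x k (e := e) f -> injective f.
Proof.
case=> fmono _ _ _ i j fij.
by case: (ltngtP i j) => [/fmono|/fmono|/val_inj //]; rewrite fij ltnn.
Qed.

(** An increasing enumeration is determined by its image. *)
Lemma block_emb_sorted (e e' : dtree X) f f' :
  block_emb b q x k (e := e) f -> block_emb b q x k (e := e') f' ->
  [seq val (f j) | j <- enum 'I_(tag e)] =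
  [seq val (f' j) | j <- enum 'I_(tag e')].
Proof.
have sorted_f (e1 : dtree X) (f1 : 'I_(tag e1) -> 'I_n) :
    block_emb b q x k f1 ->
    sorted ltn [seq val (f1 j) | j <- enum 'I_(tag e1)].
  case=> fmono _ _ _; rewrite sorted_map.
  apply: (sub_sorted (e := relpre val ltn)); first by move=> i j; apply: fmono.
  by rewrite -sorted_map val_enum_ord iota_ltn_sorted.
have mem_f (e1 : dtree X) (f1 : 'I_(tag e1) -> 'I_n) :
    block_emb b q x k f1 ->
    forall i, (i \in [seq val (f1 j) | j <- enum 'I_(tag e1)]) =
              (i \in [seq val i | i <- enum 'I_n & b i == k]).
  case=> _ fP _ _ i; apply/mapP/mapP => [[j _ ->]|[i' + ->]].
    exists (f1 j) => //; rewrite mem_filter mem_enum andbT.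
    by apply/eqP/fP; exists j.
  by rewrite mem_filter => /andP[/eqP/fP[j ->] _]; exists j; rewrite ?mem_enum.
move=> fP f'P; apply: (irr_sorted_eq ltn_trans ltnn) => [||i].
- exact: sorted_f.
- exact: sorted_f.
by rewrite (mem_f _ _ fP) (mem_f _ _ f'P).
Qed.

Lemma block_emb_fun (e : dtree X) f f' :
  block_emb b q x k (e := e) f -> block_emb b q x k (e := e) f' -> f =1 f'.
Proof.
move=> fP f'P j; apply/val_inj; move: (block_emb_sorted fP f'P).
by move/eq_in_map/(_ j); rewrite mem_enum; apply.
Qed.

Lemma is_block_uniq (e e' : dtree X) :
  is_block b q x k e -> is_block b q x k e' -> e = e'.
Proof.
case=> f fP [f' f'P]; have E := block_emb_sorted fP f'P.
have tE : tag e = tag e'.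
  by have := congr1 size E; rewrite 2!size_map 2!size_enum_ord.
case: e e' tE f f' fP f'P {E} => m [t y] [m' [t' y']] /= mm'.
case: m' / mm' t' y' => t' y' f f' fP f'P.
have ff' : f =1 f'.
  move=> j; apply/val_inj; move: (block_emb_sorted fP f'P).
  by move/eq_in_map/(_ j); rewrite mem_enum; apply.
have f_inj := block_emb_inj fP.
case: fP f'P => [_ _ fp fy] [_ _ fp' fy'].
have -> : t = t'.
  apply/val_inj/ffunP => j; have := fp' j; rewrite -ff' fp /dparent /=.
  case: (parent t j) (parent t' j) => [a|] [a'|] //= [].
  by rewrite -ff' => /f_inj ->.
by have -> : y = y' by apply: eq_from_tnth => j; have := fy' j; rewrite -ff' fy.
Qed.

End Blocks.

Section Shuffles.

Variables (X : choiceType) (r : nat) (t : rtree r) (d : r.-tuple (dtree X)).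

Local Notation pos := (Tagged (fun k : 'I_r => 'I_(tag (tnth d k)))).

(** The basis element attached to a shuffle in [spread]; the number [n] of
    labels is left free, instead of being the sum of the sizes of the entries,
    so that it can be unified with the one of a given element. *)
Definition shuffle_box n
    (s : {ffun 'I_n -> {k : 'I_r & 'I_(tag (tnth d k))}}) : box_at X r n :=
  (t, ([ffun i => tag (s i)],
       [ffun i => if parent (tagged (tnth d (tag (s i)))).1 (tagged (s i))
                       is Some j'
                  then [pick j | s j == Tagged (fun k => 'I_(tag (tnth d k))) j']
                  else None]),
   [tuple tnth (tagged (tnth d (tag (s i)))).2 (tagged (s i)) | i < n]).

Lemma card_positions : #|{: {k : 'I_r & 'I_(tag (tnth d k))}}| =
  (\sum_(k < r) tag (tnth d k))%N.
Proof.
rewrite card_tagged sumnE big_map big_enum /=.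
by apply: eq_bigr => k _; rewrite card_ord.
Qed.

(** The inverse of a shuffle restricts to increasing embeddings of the entries
    onto the blocks; conversely ([blocks_shuffle]) such embeddings glue to the
    inverse of a shuffle. *)
Lemma shuffle_blocks n (s : {ffun 'I_n -> {k : 'I_r & 'I_(tag (tnth d k))}})
    t' b q x :
  n = (\sum_(k < r) tag (tnth d k))%N -> is_shuffle s ->
  shuffle_box s = (t', (b, q), x) ->
  t = t' /\ exists g, [/\ cancel s g, cancel g s &
    forall k, block_emb b q x k (fun j : 'I_(tag (tnth d k)) => g (pos j))].
Proof.
move=> nE /andP[/injectiveP s_inj /forallP s_mono] [<- <- <- <-]; split=> //.
have [|g sK gK] := inj_card_bij s_inj.
  by rewrite card_positions card_ord -nE.
exists g; split=> // k.
split.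
- move=> j j' jj'; rewrite ltnNge leq_eqVlt; apply/negP => /orP[/eqP/val_inj|].
    by move/(can_inj gK) => E; rewrite (Tagged_inj E) ltnn in jj'.
  move=> gjj'; have /forallP/(_ (g (pos j))) := s_mono (g (pos j')).
  by rewrite !gK /= eqxx gjj' /= ltnNge ltnW.
- move=> i; rewrite ffunE; split=> [|[j ->]]; last by rewrite gK.
  rewrite -{2}(sK i); case: (s i) => k' j /= kk'.
  by case: k / kk'; exists j.
- move=> j; rewrite ffunE gK /= /dparent; case: (parent _ j) => [j'|] //=.
  case: pickP => [i /eqP si|/(_ (g (pos j')))]; first by rewrite -si sK.
  by rewrite gK eqxx.
- by move=> j; rewrite tnth_mktuple gK.
Qed.

(** A shuffle is determined by its blocks, being increasing on each of them. *)
Lemma shuffle_box_inj n : n = (\sum_(k < r) tag (tnth d k))%N ->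
  {in @is_shuffle _ _ n &, injective (@shuffle_box n)}.
Proof.
move=> nE s s' sP s'P E.
case bE: (shuffle_box s') E => [[t' [b q]] x] E.
have [_ [g [sK gK gP]]] := shuffle_blocks nE sP E.
have [_ [g' [s'K gK' gP']]] := shuffle_blocks nE s'P bE.
have gg' : g =1 g' by case=> k j; apply: (block_emb_fun (gP k) (gP' k)).
by apply/ffunP => i; apply: (can_inj gK); rewrite sK gg' s'K.
Qed.

Lemma blocks_shuffle n b q (x : n.-tuple X) :
  (forall k, is_block b q x k (tnth d k)) ->
  n = (\sum_(k < r) tag (tnth d k))%N /\
  exists2 s, is_shuffle s & shuffle_box s = (t, (b, q), x).
Proof.
move=> /fin_all_exists[F FP].
pose J (y : {k : 'I_r & 'I_(tag (tnth d k))}) := F (tag y) (tagged y).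
have bJ y : b (J y) = tag y.
  by case: (FP (tag y)) => _ bP _ _; apply/bP; exists (tagged y).
have J_inj : injective J.
  case=> k j [k' j'] E; have kk' : k = k' by have := bJ (pos j); rewrite E bJ.
  by case: k' / kk' j' E => j' /(block_emb_inj (FP k)) /= ->.
have J_surj i : exists y, J y == i.
  have [_ bP _ _] := FP (b i); have [j jE] := (bP i).1 erefl.
  by exists (pos j); rewrite /J -jE.
have [s0 s0P] := fin_all_exists J_surj.
pose s := finfun s0; have sK i : J (s i) = i by rewrite ffunE (eqP (s0P i)).
have JK y : s (J y) = y by apply: J_inj; rewrite sK.
split.
  rewrite -card_positions -[LHS]card_ord.
  by apply/esym/(bij_eq_card (f := J)); exists s.
have tag_s i : tag (s i) = b i by rewrite -bJ sK.
exists s.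
  apply/andP; split; first by apply/injectiveP; apply: can_inj sK.
  apply/forallP => i; apply/forallP => j; apply/implyP => /andP[].
  move: (sK i) (sK j).
  case: (s i) (s j) => k a [k' a'] <- <- /= /eqP kk';
    case: k' / kk' a' => a' aa'.
  have [Fmono _ _ _] := FP k; rewrite ltnNge leq_eqVlt;
    apply/negP => /orP[/eqP/val_inj E|/Fmono].
    by rewrite E ltnn in aa'.
  by rewrite ltnNge ltnW.
congr (_, (_, _), _).
- by apply/ffunP => i; rewrite ffunE tag_s.
- apply/ffunP => i; rewrite ffunE; move: (sK i).
  case: (s i) => k j <- /=; have [_ _ -> _] := FP k; rewrite /dparent /=.
  case: (parent _ j) => [j'|] //=; case: pickP => [i' /eqP si'|].
    by rewrite -[i']sK si'.
  by move/(_ (J (pos j'))); rewrite JK eqxx.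
apply: eq_from_tnth => i; rewrite tnth_mktuple; move: (sK i).
by case: (s i) => k j <- /=; have [_ _ _ ->] := FP k.
Qed.

End Shuffles.

Lemma spread_shuffles (K : comNzRingType) (X : choiceType) r (t : rtree r)
    (d : r.-tuple (dtree X)) (z : box_at X r (\sum_(k < r) tag (tnth d k))) :
  (spread K (DTree t d))@_(Box z) =
  \sum_(s | is_shuffle s) (shuffle_box t (d := d) s == z)%:R.
Proof.
transitivity (\sum_(s : {ffun 'I_(\sum_(k < r) tag (tnth d k)) ->
                                 {k : 'I_r & 'I_(tag (tnth d k))}} |
                    is_shuffle s)
    (<< Box (r := r) (shuffle_box t s) >> : {malg K[box X]})@_(Box z)).
  exact: raddf_sum.
apply: eq_bigr => s _; rewrite mcoeffU; congr ((_ : bool)%:R).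
by apply/eqP/eqP => [E|-> //]; exact: (Tagged_inj E).
Qed.

Section Spread.

Variables (K : comNzRingType) (X : choiceType) (r n : nat).
Variables (b : {ffun 'I_n -> 'I_r}) (q : parent_map 'I_n) (x : n.-tuple X).

Lemma spread_support t D :
  (spread K D)@_(Box (t, (b, q), x)) != 0 ->
  exists d, D = DTree t d /\ forall k, is_block b q x k (tnth d k).
Proof.
case: D => r0 [t0 d0]; rewrite /spread /= raddf_sum /= => /sum_neq0[s [_ sP]].
rewrite mcoeffU; case: (_ =P Box _) => [E _|]; last by rewrite eqxx.
have rr0 : r0 = r by have := congr1 (fun z => (tag z).1) E.
have nE : n = (\sum_(k < r0) tag (tnth d0 k))%N.
  by have := congr1 (fun z => (tag z).2) E.
case: r / rr0 t b E => t b' E; exists d0.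
case: n / (esym nE) q x b' E => q' x' b' E; have {}E := Tagged_inj E.
have [<- [g [_ _ gP]]] := shuffle_blocks (t := t0) erefl sP E; split=> // k.
by eexists; apply: gP.
Qed.

Lemma spread_coeff1 t (d : r.-tuple (dtree X)) :
  (forall k, is_block b q x k (tnth d k)) ->
  (spread K (DTree t d))@_(Box (t, (b, q), x)) = 1.
Proof.
move=> /(blocks_shuffle t)[nE]; case: n / (esym nE) b q x => b' q' x' [s sP sE].
rewrite spread_shuffles -sE (bigD1 s) // eqxx big1 => [|s' /andP[s'P]].
  by rewrite Monoid.mulm1.
case: (_ =P shuffle_box t s) => // E.
by rewrite (shuffle_box_inj erefl s'P sP E) eqxx.
Qed.

Variable v : {malg K[dtree (dtree X)]}.

Lemma linext_spread_support t :
  (linext (@spread K X) v)@_(Box (t, (b, q), x)) != 0 ->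
  exists d, v@_(DTree t d) != 0 /\ forall k, is_block b q x k (tnth d k).
Proof.
rewrite linext_coeff => /sum_neq0[D [_ _ vD]].
have [d [DE dP]] :
    exists d, D = DTree t d /\ forall k, is_block b q x k (tnth d k).
  apply: spread_support; apply: contraNneq vD => ->; by rewrite mulr0.
by exists d; split=> //; apply: contraNneq vD; rewrite DE => ->; rewrite mul0r.
Qed.

(** Only one family of trees can be spread to a given element, namely the one
    of its renumbered blocks; hence no two terms add up. *)
Lemma linext_spread_coeff t (d : r.-tuple (dtree X)) :
  (forall k, is_block b q x k (tnth d k)) ->
  (linext (@spread K X) v)@_(Box (t, (b, q), x)) = v@_(DTree t d).
Proof.
move=> dP; rewrite linext_coeff.
have other D : D != DTree t d -> (spread K D)@_(Box (t, (b, q), x)) = 0.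
  move=> Dd; apply/eqP/negPn/negP => /spread_support[d' [DE d'P]].
  case/eqP: Dd; rewrite DE; congr DTree; apply: eq_from_tnth => k.
  exact: is_block_uniq (d'P k) (dP k).
have [dv|dv] := boolP (DTree t d \in msupp v).
  rewrite (bigD1_seq _ dv) ?fset_uniq //= spread_coeff1 // mulr1.
  by rewrite big1 ?addr0 // => D /other ->; rewrite mulr0.
rewrite (mcoeff_outdom dv) big_seq big1 // => D Dv.
by rewrite other ?mulr0 //; apply: contraNneq dv => <-.
Qed.

End Spread.

(** * Composition with a single vertex at the root *)

Lemma linextU (K : comNzRingType) (A B : choiceType) (F : A -> {malg K[B]}) a :
  linext F << a >> = F a.
Proof.
apply/malgP => c; rewrite linext_coeff msuppU oner_eq0 big_seq_fset1.
by rewrite mcoeffUU mul1r.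
Qed.

(** No choice is left if there is no edge to attach, or a single vertex to
    attach edges to. *)
Lemma circ_single (K : comNzRingType) (L : finType) (t u : ltree L) (i o : L) :
  (forall j, j \in In_edges t i -> u.1 = [set o]) ->
  circ K t i u =
  << circ_at t i u [ffun j => if j \in In_edges t i then o else i] >>.
Proof.
move=> uo; rewrite /circ; set f0 := finfun _.
rewrite (big_pred1 f0) // => f; apply/pffun_onP/eqP => [[fi fu]|->].
  apply/ffunP => j; rewrite ffunE; case: ifP => jI.
    have : f j \in u.1 by apply: fu; apply: image_f.
    by rewrite (uo j jI) => /set1P.
  apply/eqP; apply: contraFT jI => fji; exact: (subsetP fi).
split=> [|_ /imageP[j jI ->]]; last by rewrite ffunE jI (uo j jI) set11.
by apply/subsetP => j; rewrite unfold_in ffunE; case: ifP => //; rewrite eqxx.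
Qed.

Section Star.

Variables (K : comNzRingType) (X : choiceType) (r n : nat).
Variables (t : rtree r) (b : {ffun 'I_n -> 'I_r}) (q : parent_map 'I_n).
Variables (c : 'I_r) (i0 : 'I_n).

Hypothesis t_star : forall k, parent t k = if k == c then None else Some c.
Hypothesis b_root : forall i, (b i == c) = (i == i0).

(** The expected composition: all the roots of the blocks but [i0] are attached
    to [i0]. *)
Definition graft : parent_map 'I_n :=
  [ffun i => if q i is Some j then Some j
             else if i == i0 then None else Some i0].

Definition hub (S : seq 'I_r) : 'I_r + 'I_n :=
  if c \in S then inr i0 else inl c.

(** The tree obtained after the vertices of [S] have been substituted; its edges
    to the root point to [hub S], which changes when the root is substituted. *)
Definition stage (S : seq 'I_r) : ltree ('I_r + 'I_n)%type :=
  ([set l | match l with inl k => k \notin S | inr i => b i \in S end],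
   [ffun l => match l with
      | inl k => if (k \notin S) && (k != c) then Some (hub S) else None
      | inr i => if b i \notin S then None
                 else if q i is Some j then Some (inr j)
                 else if i == i0 then None else Some (hub S)
      end]).

Lemma stage_nil : outer_ltree n t = stage [::].
Proof.
congr (_, _).
  apply/setP => -[k|i]; rewrite !inE; last by apply/imsetP => -[].
  by apply/imsetP; exists k.
apply/ffunP => -[k|i]; rewrite !ffunE //= t_star.
by case: (k == c).
Qed.

Lemma stage_cons S k :
  k \notin S ->
  circ K (stage S) (inl k) (block_ltree b q k) = << stage (k :: S) >>.
Proof.
move=> kS; have In_stage l : l \in In_edges (stage S) (inl k) -> k = c.
  rewrite inE ffunE => H; have : hub S == inl k.
    case: l H => [k'|i]; first by case: ifP.
    by case: ifP => //= _; case: (q i) => // ; case: ifP.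
  by rewrite /hub; case: ifP => // cS /eqP[].
have blockP i : (inr i \in (block_ltree b q k).1) = (b i == k).
  apply/imsetP/idP => [[i' + [->]]|bik]; first by rewrite inE.
  by exists i; rewrite ?inE.
have blockN k' : (inl k' \in (block_ltree b q k).1) = false.
  by apply/negbTE/imsetP => -[].
rewrite (@circ_single K _ _ _ _ (inr i0)) => [|l /In_stage kc]; last first.
  by apply/setP => -[k'|i]; rewrite inE ?blockN // blockP kc b_root.
have hubS : hub (k :: S) = if k == c then inr i0 else hub S.
  by rewrite /hub inE eq_sym; case: (k == c).
congr << _ >>; congr (_, _).
  apply/setP => -[k'|i]; rewrite !inE ?blockN ?blockP ?orbF;
    last by rewrite orbC.
  by rewrite negb_or (inj_eq (@inl_inj _ _)).
have InE l :
    (l \in In_edges (stage S) (inl k)) = ((stage S).2 l == Some (inl k)).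
  by rewrite inE.
have hub_eq : (Some (hub S) == Some (inl k)) = (k == c).
  rewrite /hub; case: (k =P c) kS => [-> /negbTE ->|kc _]; first exact: eqxx.
  by case: ifP => _ //; apply/eqP => -[/esym].
apply/ffunP => -[k'|i]; rewrite [RHS]ffunE [LHS]ffunE ?blockN ?blockP.
  rewrite in_setD1 in_set (inj_eq (@inl_inj _ _)) in_cons negb_or.
  case: (k' =P k) => //= k'k; case k'S: (k' \in S) => //=.
  rewrite !(InE, ffunE) k'S /= hubS.
  case k'c: (k' == c) => //=; rewrite hub_eq.
  by case: (k == c).
rewrite in_setD1 in_set in_cons.
case: (b i =P k) => [bik|bik] /=.
  rewrite !ffunE bik eqxx; case: (q i) => [j|] //=.
  by rewrite kS /= hubS -b_root bik; case: (k == c).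
case biS: (b i \in S) => //=; rewrite !(InE, ffunE) biS /=.
case: (q i) => [j|] //=; case: (i =P i0) => [//|ii0]; rewrite hub_eq hubS.
by case: (k == c).
Qed.

Lemma compose_star : compose_ltree K t b q = << stage (rev (enum 'I_r)) >>.
Proof.
pose F v k := linext (fun t' => circ K t' (inl k) (block_ltree b q k)) v.
have foldl_stage s S : uniq s -> {in s, forall k, k \notin S} ->
    foldl F << stage S >> s = << stage (catrev s S) >>.
  elim: s S => [|k s IH] S //= /andP[ks sU] sS.
  rewrite {2}/F linextU stage_cons ?sS ?mem_head // IH // => l ls.
  rewrite in_cons negb_or sS ?in_cons ?ls ?orbT // andbT.
  by apply: contraNneq ks => <-.
by rewrite /compose_ltree stage_nil foldl_stage ?enum_uniq.
Qed.

Lemma compose_at_coeff (x : n.-tuple X) (t1 : rtree n) (x1 : n.-tuple X) :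
  (compose_at K (t, (b, q), x))@_(DTree t1 x1) =
  ((graft == parent t1) && (x == x1))%:R.
Proof.
rewrite /compose_at compose_star linextU.
have -> : to_parent_map (stage (rev (enum 'I_r))) = graft.
  apply/ffunP => i; rewrite !ffunE mem_rev mem_enum /=.
  case: (q i) => [j|] //; case: ifP => // _.
  by rewrite /hub mem_rev mem_enum.
case: insubP => [t2 _ t2E|]; last first.
  by case: eqP => [->|_ _]; rewrite ?mcoeff0 //; case: (t1) => /= p ->.
rewrite mcoeffU -t2E -val_eqE; congr ((_ : bool)%:R).
by rewrite /DTree eq_Tagged.
Qed.

End Star.

(** * The monad multiplication *)

Section MuCoeff.

Variables (K : comNzRingType) (X : choiceType).

Lemma trace_inv_coeff (w : {malg K[box X]}) z :
  (trace_inv w)@_z = w@_z *+ (choose (mem (orbit_box z)) z == z).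
Proof.
rewrite /trace_inv raddf_sum /=.
under eq_bigr => y _ do rewrite mcoeffZ mcoeffU.
have [zw|zw] := boolP (z \in msupp w); last first.
  rewrite (mcoeff_outdom zw) mul0rn big_seq_cond big1 // => y /andP[yw _].
  by case: eqP => [yz|_]; rewrite ?mulr0 // -yz yw in zw *.
rewrite big_mkcond /= (bigD1_seq z) ?fset_uniq //= eqxx mulr1 big1 ?addr0.
  by case: eqP.
by move=> y yz; rewrite (negbTE yz) mulr0 if_same.
Qed.

Variables (v : {malg K[dtree (dtree X)]}) (u : dtree X).

Let w := linext (@spread K X) v.

Lemma mu_support : (mu v)@_u != 0 ->
  exists z, w@_z != 0 /\ (compose_at K (tagged z))@_u != 0.
Proof.
rewrite /mu linext_coeff => /sum_neq0[z [_ _ H]]; exists z; split.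
  by apply: contraNneq H => wz; rewrite trace_inv_coeff wz mul0rn mul0r.
by apply: contraNneq H => ->; rewrite mulr0.
Qed.

(** If the terms contributing to [u] form a single orbit and contribute 1 each,
    then exactly one of them, the representative chosen by [trace_inv], is
    counted. *)
Lemma mu_coeff1 r n (z0 : box_at X r n) :
  (forall p, w@_(act_box p z0) = 1) ->
  (forall p, (compose_at K (tagged (act_box p z0)))@_u = 1) ->
  (forall z, w@_z != 0 -> (compose_at K (tagged z))@_u != 0 ->
     exists p, z = act_box p z0) ->
  (mu v)@_u = 1.
Proof.
move=> w1 c1 only; rewrite /mu linext_coeff.
pose rep (z : box X) := choose (mem (orbit_box z)) z.
have repE p : rep (act_box p z0) = rep (Box z0) :=
  choose_orbit_box (z := Box z0) p.
have [p repP] : exists p, rep (Box z0) = act_box p z0.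
  have /imageP[p _ ->] : rep (Box z0) \in mem (orbit_box (Box z0)).
    by apply: chooseP; apply/imageP; exists 1%g; rewrite ?act_box1.
  by exists p.
have wp : (trace_inv w)@_(act_box p z0) = 1.
  by rewrite trace_inv_coeff w1 -/(rep _) repE repP eqxx.
rewrite (bigD1_seq (act_box p z0)) ?fset_uniq //=; last first.
  by rewrite -mcoeff_neq0 wp oner_neq0.
rewrite wp c1 mulr1 big1 ?addr0 // => z zp; apply/eqP.
apply: contraNT zp => H; apply/eqP.
have wz : w@_z != 0.
  by apply: contraNneq H => wz; rewrite trace_inv_coeff wz mul0rn mul0r.
have rz : rep z = z.
  move: H; rewrite trace_inv_coeff -/(rep z); case: (rep z =P z) => // _.
  by rewrite mulr0n mul0r eqxx.
have [|p' zE] := only _ wz; first by apply: contraNneq H => ->; rewrite mulr0.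
by rewrite -rz zE repE repP.
Qed.

End MuCoeff.

Lemma dreads_leaf (X : choiceType) (a : X) (e : dtree X) :
  dreads (Corolla a [::]) e ->
  exists r, [/\ forall i, i = r, dparent e r = None & dlabel e r = a].
Proof.
have [r [dep gr]] := dtree_grading e; rewrite (dreads_root _ gr).
case: gr => pr rP depP /readsP[xr [[|//] no_ch _]]; exists r; split=> // i.
have {}no_ch j : dparent e j <> Some r.
  by move/eqP; rewrite -mem_children -(perm_mem no_ch).
elim: (dep i) {-2}i (erefl (dep i)) => [|k IH] {}i di;
  case pi: (dparent e i) => [j|]; try exact: rP.
  by rewrite (depP _ _ pi) in di.
by case: (no_ch i); rewrite pi (IH j) //; apply/succn_inj;
  rewrite -(depP _ _ pi).
Qed.

Lemma dreads_corolla0 (X : choiceType) (a : X) :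
  dreads (Corolla a [::]) (corolla_dtree a [::]).
Proof.
apply/existsP; exists ord0; apply/andP; split;
  first by rewrite /dparent /= ffunE.
apply/readsP; split=> //; exists [::] => //.
case E: (children _ _) => [//|c cs].
have : c \in c :: cs := mem_head _ _.
by rewrite -E mem_children /dparent /= ffunE ord1.
Qed.

(** A block with a single root is a tree: the depth in the forest is a grading
    of the block. *)
Lemma block_exists (X : choiceType) r n (b : {ffun 'I_n -> 'I_r})
    (q : parent_map 'I_n) (x : n.-tuple X) (dep : 'I_n -> nat) k c :
  (forall i j, q i = Some j -> dep i = (dep j).+1 /\ b j = b i) ->
  b c = k -> q c = None -> (forall i, b i = k -> q i = None -> i = c) ->
  exists (e : dtree X) f rt,
    [/\ block_emb b q x k (e := e) f, dparent e rt = None & f rt = c].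
Proof.
move=> qP bc qc cP; pose A := [set i | b i == k].
pose f (j : 'I_#|A|) : 'I_n := enum_val j.
have fA j : b (f j) = k by have := enum_valP j; rewrite inE => /eqP.
have f_inj : injective f := @enum_val_inj _ _.
have f_surj i : b i = k -> exists j, f j = i.
  move=> bi; have iA : i \in A by rewrite inE bi.
  by exists (enum_rank_in iA i); apply: enum_rankK_in.
have [rt frt] := f_surj c bc.
pose p : parent_map 'I_#|A| :=
  [ffun j => if q (f j) is Some i then [pick j' | f j' == i] else None].
have fp j : q (f j) = omap f (p j).
  rewrite ffunE; case qj: (q (f j)) => [i|] //=.
  case: pickP => [j' /eqP <- //|no]; have [_ bi] := qP _ _ qj.
  by have [|j' j'i] := f_surj i; [rewrite bi fA | have := no j';
    rewrite j'i eqxx].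
have pT : is_rtree [set: 'I_#|A|] p.
  apply: (@grading_rtree _ _ rt (dep \o f)); split=> [|j pj|j j' pj].
  - by have := fp rt; rewrite frt qc; case: (p rt).
  - by apply: f_inj; rewrite frt; apply: cP (fA j) _; rewrite fp pj.
  by have [|dE _] := qP (f j) (f j'); [rewrite fp pj | exact: dE].
exists (DTree (RTree pT) [tuple tnth x (f j) | j < #|A|]), f, rt; split=> //.
  split=> [i j ij|i|j|j].
  - rewrite /f !(enum_val_nth c).
    have srt : sorted ltn [seq val i | i <- enum A].
      have -> : enum A = [seq i <- enum 'I_n | i \in A].
        rewrite {2}/enum_mem -filter_predI.
        by apply: eq_filter => y; rewrite /= andbT.
      rewrite sorted_map; apply: sorted_filter.
        by move=> ? ? ?; apply: ltn_trans.
      by rewrite -sorted_map val_enum_ord iota_ltn_sorted.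
    have ltA (l : 'I_#|A|) : (l < size (enum A))%N by rewrite -cardE.
    have := sorted_ltn_nth ltn_trans 0 srt.
    move/(_ i j); rewrite !inE !size_map => /(_ (ltA i) (ltA j) ij).
    by rewrite !(nth_map c).
  - by split=> [/f_surj[j <-]|[j ->]]; [exists j | exact: fA].
  - exact: fp.
  by rewrite /dlabel tnth_mktuple.
by have := fp rt; rewrite frt qc /dparent /=; case: (p rt).
Qed.

(** * Partitions of a tree into its root and its branches *)

Definition cut (T : finType) (p : parent_map T) (r : T) : parent_map T :=
  [ffun i => if p i is Some j then if j == r then None else Some j else None].

Section Branches.

Variables (X : choiceType) (a : X) (Ms : seq (monomial X)) (m : nat).
Hypothesis size_Ms : size Ms = m.

(** The root entry of the corolla is described by the one-vertex monomial, so
    that it is treated on the same footing as the other entries. *)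
Definition corolla_entry (k : 'I_m.+1) : monomial X :=
  nth (Corolla a [::]) (Corolla a [::] :: Ms) k.

(** The terms which occur in the orbit sum of the corolla with root [a] and
    entries [Ms]; [s] records how the vertices of the corolla are labelled. *)
Definition branches n (s : 'S_m.+1) (z : box_at X m.+1 n) : Prop :=
  z.1.1 = relabel s (corolla m) /\
  forall k, exists e,
    dreads (corolla_entry ((s^-1)%g k)) e /\ is_block z.1.2.1 z.1.2.2 z.2 k e.

Lemma relabel_corolla (s : 'S_m.+1) k :
  parent (relabel s (corolla m)) k =
  if k == s ord0 then None else Some (s ord0).
Proof.
rewrite /= !ffunE; have -> : ((s^-1)%g k == ord0) = (k == s ord0).
  by apply/eqP/eqP => [<-|->]; rewrite ?permKV ?permK.
by case: (k == s ord0).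
Qed.

Lemma branches_act n s (z : box_at X m.+1 n) p :
  branches s z -> branches (s * p)%g (tagged (act_box p z)).
Proof.
case: z => [[t [b q]] x] [/= tE blk]; split.
  apply/val_inj/ffunP => k; rewrite [RHS]relabel_corolla [LHS]ffunE tE.
  rewrite relabel_corolla permM -{2}(permKV p k) (inj_eq perm_inj).
  by case: (_ == s ord0).
move=> k; have [e [eM [f [f1 f2 f3 f4]]]] := blk ((p^-1)%g k).
exists e; split; first by rewrite invMg permM.
exists f; split=> // i; rewrite ffunE; split=> [pb|/f2 ->].
  by apply/f2; rewrite /= -pb permK.
by rewrite permKV.
Qed.

Section Valid.

Variables (n : nat) (s : 'S_m.+1) (t : rtree m.+1).
Variables (b : {ffun 'I_n -> 'I_m.+1}) (q : parent_map 'I_n) (x : n.-tuple X).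
Hypothesis zP : branches s (t, (b, q), x).

Lemma branches_star k :
  parent t k = if k == s ord0 then None else Some (s ord0).
Proof. by case: zP => /= -> _; apply: relabel_corolla. Qed.

(** The tree on the block of the root of the corolla reads a monomial without
    entries, so it has no edge. *)
Lemma branches_center : exists i0,
  [/\ forall i, (b i == s ord0) = (i == i0), q i0 = None & tnth x i0 = a].
Proof.
have [_ /(_ (s ord0))[e [eM [f /= [_ fb fq fx]]]]] := zP.
move: eM; rewrite permK => /dreads_leaf[r [rP pr xr]].
exists (f r); split; last by rewrite fx.
  move=> i; apply/eqP/eqP => [/fb[j ->]|->]; first by rewrite (rP j).
  by apply/fb; exists r.
by rewrite fq pr.
Qed.

Lemma branches_parent i j : q i = Some j -> b j = b i.
Proof.
have [_ /(_ (b i))[e [_ [f /= [_ fb fq _]]]]] := zP.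
have [i' iE] := (fb i).1 erefl; rewrite [in q _]iE fq.
by case: (dparent e i') => [j'|] //= [<-]; apply/fb; exists j'.
Qed.

Lemma branches_root k : exists c,
  [/\ b c = k, q c = None & forall i, b i = k -> q i = None -> i = c].
Proof.
have [_ /(_ k)[e [_ [f /= [_ fb fq _]]]]] := zP.
have [r [dep [pr rP _]]] := dtree_grading e.
exists (f r); split; first by apply/fb; exists r.
  by rewrite fq pr.
move=> i /fb[j ->]; rewrite fq => pj; rewrite (rP j) //.
by case: (dparent e j) pj.
Qed.

Variables (i0 : 'I_n) (p : rtree n).
Hypothesis b_center : forall i, (b i == s ord0) = (i == i0).
Hypothesis q_center : q i0 = None.
Hypothesis graftE : graft q i0 = parent p.

Lemma center_not_parent i : q i <> Some i0.
Proof.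
move=> qi; have := branches_parent qi; move/eqP.
rewrite eq_sym (eqP (etrans (b_center i0) (eqxx _))) b_center => /eqP ii0.
by rewrite ii0 q_center in qi.
Qed.

Lemma graft_parent i : parent p i =
  if q i is Some j then Some j else if i == i0 then None else Some i0.
Proof. by rewrite -graftE ffunE. Qed.

(** The forest is recovered from the composed tree, because no vertex of the
    forest has [i0] as parent. *)
Lemma graft_cut : q = cut (parent p) i0.
Proof.
apply/ffunP => i; rewrite ffunE graft_parent; case qi: (q i) => [j|].
  by case: eqP => // ji0; case: (center_not_parent (i := i)); rewrite qi ji0.
by case: (i == i0); rewrite ?eqxx.
Qed.

Lemma graft_root i : parent p i = None -> i = i0.
Proof. by rewrite graft_parent; case: (q i) => //; case: eqP. Qed.

(** The children of the root of the composed tree are the roots of the other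
    blocks, and the subtrees at these children are the blocks. *)
Lemma branches_reads : tnth x i0 = a -> dreads (Corolla a Ms) (DTree p x).
Proof.
move=> xi0; apply/existsP; exists i0.
rewrite /dparent /dlabel /= graft_parent q_center eqxx /=.
have branch (l : 'I_m) : exists j,
    [/\ b j = s (lift ord0 l), q j = None,
        forall i, b i = s (lift ord0 l) -> q i = None -> i = j
      & reads (parent p) (tnth x) (nth (Corolla a [::]) Ms l) j].
  have [_ /(_ (s (lift ord0 l)))[e [eM [f fP]]]] := zP.
  have [/= fm fb fq fx] := fP; move: eM; rewrite permK /corolla_entry /= => eM.
  have [r [dep gr]] := dtree_grading e; rewrite (dreads_root _ gr) in eM.
  case: gr => pr rP _.
  have bf j : b (f j) = s (lift ord0 l) by apply/fb; exists j.
  exists (f r); split=> //; first by rewrite fq pr.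
    move=> i /fb[j ->]; rewrite fq => pj; rewrite (rP j) //.
    by case: (dparent e j) pj.
  rewrite (reads_transport (p' := dparent e) (x' := dlabel e)) //.
    exact: block_emb_inj fP.
  move=> c j; rewrite graft_parent; split=> [|[c' -> pc']]; last first.
    by rewrite fq pc'.
  case qc: (q c) => [j'|].
    case=> j'E; have [|c' cE] := (fb c).1;
      first by rewrite -(branches_parent qc) j'E.
    exists c' => //; move: qc; rewrite cE fq j'E.
    by case: (dparent e c') => //= y [/(block_emb_inj fP) ->].
  case: ifP => // _ [i0E]; have := bf j; rewrite -i0E => /eqP.
  by rewrite (eqP (etrans (b_center i0) (eqxx _))) (inj_eq perm_inj).
have [j jP] := fin_all_exists branch.
have j_inj : injective j.
  move=> l l' jl; have [bl _ _ _] := jP l; have [bl' _ _ _] := jP l'.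
  by move: bl; rewrite jl bl' => /perm_inj/lift_inj.
apply/readsP; split=> //; exists (map j (enum 'I_m)); last first.
  apply: (all2_from_nth (x0 := Corolla a [::]) (y0 := i0)) => [|k].
    by rewrite size_map size_enum_ord.
  rewrite size_Ms => km; have [_ _ _] := jP (Ordinal km).
  rewrite (nth_map (Ordinal km)) ?size_enum_ord //.
  by rewrite (nth_ord_enum _ (Ordinal km)).
apply: uniq_perm => [||i].
- by rewrite map_inj_uniq // enum_uniq.
- exact: children_uniq.
rewrite mem_children; apply/mapP/eqP => [[l _ ->]|].
  rewrite graft_parent; have [bl -> _ _] := jP l.
  by rewrite -b_center bl (inj_eq perm_inj).
rewrite graft_parent; case qi: (q i) => [i'|].
  by case=> i'E; case: (center_not_parent (i := i)); rewrite qi i'E.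
rewrite -b_center; case: eqP => // bi _.
case: (unliftP ord0 ((s^-1)%g (b i))) => [l lE|bE]; last first.
  by case: bi; rewrite -bE permKV.
exists l; rewrite ?mem_enum //; have [_ _ H _] := jP l.
by apply: H => //; rewrite -lE permKV.
Qed.

End Valid.

(** Both elements have the same forest, obtained by cutting the edges entering
    the root of [p].  A block is connected, so the label in [b'] of a vertex is
    the one of the root of its block for [b]; thus [b] and [b'] differ by a
    permutation of the labels, which also relates the two corollas. *)
Lemma branches_orbit n (s s' : 'S_m.+1) t t' (b b' : {ffun 'I_n -> 'I_m.+1})
    q q' (x : n.-tuple X) i0 i0' (p : rtree n) :
  branches s (t, (b, q), x) -> branches s' (t', (b', q'), x) ->
  (forall i, (b i == s ord0) = (i == i0)) -> q i0 = None ->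
  (forall i, (b' i == s' ord0) = (i == i0')) -> q' i0' = None ->
  graft q i0 = parent p -> graft q' i0' = parent p ->
  exists g, Box (t', (b', q'), x) = act_box g (t, (b, q), x).
Proof.
move=> zP z'P b0 q0 b0' q0' gp gp'.
have ii' : i0 = i0'.
  by apply: (graft_root gp'); rewrite (graft_parent gp) q0 eqxx.
case: i0' / ii' b0' q0' gp' => b0' q0' gp'.
have qq' : q = q'.
  by rewrite (graft_cut zP b0 q0 gp) (graft_cut z'P b0' q0' gp').
case: q' / qq' z'P q0' gp' => z'P _ _.
have [r [dep [_ _ depP]]] : exists r dep, grading (parent p) r dep.
  by apply: rtree_grading; case: (p).
have const (b1 : {ffun 'I_n -> 'I_m.+1}) (b2 : {ffun 'I_n -> 'I_m.+1}) c :
    (forall i j, q i = Some j -> b1 j = b1 i) ->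
    (forall i j, q i = Some j -> b2 j = b2 i) ->
    (forall k i, b1 i = k -> q i = None -> i = c k) ->
    forall i, b2 i = b2 (c (b1 i)).
  move=> b1P b2P cP i.
  elim: (dep i) {-2}i (erefl (dep i)) => [|k IH] {}i di; case qi: (q i) => [j|].
  - by rewrite (depP i j) // in di; rewrite (graft_parent gp) qi.
  - by rewrite -(cP _ _ erefl qi).
  - rewrite -(b1P _ _ qi) -(b2P _ _ qi); apply: IH; apply/succn_inj.
    by rewrite -(depP i j) // (graft_parent gp) qi.
  - by rewrite -(cP _ _ erefl qi).
have [c cP] := fin_all_exists (branches_root zP).
have [c' c'P] := fin_all_exists (branches_root z'P).
have bb' : forall i, b' i = b' (c (b i)).
  apply: const => [||k i].
  - exact: branches_parent zP.
  - exact: branches_parent z'P.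
  by have [_ _] := cP k; apply.
have b'b : forall i, b i = b (c' (b' i)).
  apply: const => [||k i].
  - exact: branches_parent z'P.
  - exact: branches_parent zP.
  by have [_ _] := c'P k; apply.
have g_inj : injective (fun k => b' (c k)).
  apply: (can_inj (g := fun k => b (c' k))) => k.
  by rewrite -b'b; case: (cP k).
exists (perm g_inj); rewrite /act_box /=; congr (Box (_, (_, _), _)).
  apply/val_inj/ffunP => k; rewrite [RHS]ffunE.
  rewrite (branches_star z'P) (branches_star zP).
  have -> : s' ord0 = perm g_inj (s ord0).
    rewrite permE -(eqP (etrans (b0 i0) (eqxx _))) -bb'.
    by apply/esym/eqP; rewrite b0'.
  rewrite -{1}(permKV (perm g_inj) k) (inj_eq perm_inj).
  by case: (_ == s ord0).
by apply/ffunP => i; rewrite ffunE permE.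
Qed.

(** The block labels are propagated from the root upwards: 0 for the root, and
    [l.+1] for the [l]-th child in the ordering [js] given by the reading. *)
Lemma branches_exist n (p : rtree n) (x : n.-tuple X) :
  dreads (Corolla a Ms) (DTree p x) ->
  exists t b q i0, [/\ branches 1%g (t, (b, q), x),
    forall i, (b i == (1%g : 'S_m.+1) ord0) = (i == i0), q i0 = None
    & graft q i0 = parent p].
Proof.
have [r [dep gr]] := dtree_grading (DTree p x); rewrite (dreads_root _ gr).
case: gr => pr rP depP /readsP[xr [js js_ch Mjs]].
rewrite /dparent /dlabel /= in pr rP depP xr js_ch Mjs.
have [/esym sz Mjs_nth] := all2_to_nth (Corolla a [::]) r Mjs;
  rewrite size_Ms in sz.
have jsP i : (i \in js) = (parent p i == Some r).
  by rewrite (perm_mem js_ch) mem_children.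
have js_uniq : uniq js by rewrite (perm_uniq js_ch) children_uniq.
have [b0 b0E] := top_down (fun=> ord0 : 'I_m.+1)
  (fun i j bj => if j == r then inord (index i js).+1 else bj) depP.
pose b : {ffun 'I_n -> 'I_m.+1} := finfun b0.
have bE i : b i = if parent p i is Some j
                  then if j == r then inord (index i js).+1 else b j else ord0.
  by rewrite !ffunE b0E; case: (parent p i) => // j; rewrite ffunE.
pose q := cut (parent p) r.
have qE i : q i = if parent p i is Some j then if j == r then None else Some j
                  else None by rewrite ffunE.
have b_js l : (l < m)%N -> b (nth r js l) = inord l.+1.
  move=> lm; have : nth r js l \in js by rewrite mem_nth // sz.
  by rewrite jsP bE => /eqP ->; rewrite eqxx index_uniq // sz.
have bq i j : q i = Some j -> b j = b i.
  rewrite qE (bE i); case pi: (parent p i) => [j'|] //.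
  by case: ifP => // _ [->].
have q_root i : q i = None -> i = r \/ i \in js.
  rewrite qE jsP; case pi: (parent p i) => [j'|]; last by left; apply: rP.
  by case: eqP => // -> _; right.
have b_center i : (b i == ord0) = (i == r).
  apply/eqP/eqP => [|->]; last by rewrite bE pr.
  elim: (dep i) {-2}i (erefl (dep i)) => [|k IH] {}i di; case qi: (q i) => [j|].
  - move: qi; rewrite qE; case pi: (parent p i) => //.
    by rewrite (depP _ _ pi) in di.
  - case: (q_root _ qi) => // /(nthP r)[l]; rewrite sz => lm <-.
    by rewrite b_js // => /(congr1 val); rewrite /= inordK.
  - rewrite -(bq _ _ qi) => /IH H.
    move: qi; rewrite qE; case pi: (parent p i) => [j'|] //;
      case: eqP => // j'r [jE].
    by case: j'r; rewrite jE H // -jE; apply/succn_inj; rewrite -(depP _ _ pi).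
  - case: (q_root _ qi) => // /(nthP r)[l]; rewrite sz => lm <-.
    by rewrite b_js // => /(congr1 val); rewrite /= inordK.
have qr : q r = None by rewrite qE pr.
exists (relabel 1%g (corolla m)), b, q, r; split=> //; last first.
- apply/ffunP => i; rewrite ffunE qE; case pi: (parent p i) => [j|].
    by case: eqP => [->|//]; case: eqP => // ir; rewrite ir pr in pi.
  by rewrite (rP _ pi) eqxx.
- by move=> i; rewrite perm1 b_center.
split=> //= k; rewrite invg1 perm1.
case: (unliftP ord0 k) => [l ->|->]; last first.
  exists (corolla_dtree a [::]); split; first exact: dreads_corolla0.
  exists (fun=> r); split=> [i j|i|j|j].
  - by rewrite !ord1.
  - split=> [/eqP|[_ ->]]; last by apply/eqP; rewrite b_center.
    by rewrite b_center => /eqP ->; exists ord0.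
  - by rewrite qr /dparent /= ffunE ord1.
  by rewrite xr ord1.
have dq i j : q i = Some j -> dep i = (dep j).+1 /\ b j = b i.
  move=> qi; split; last exact: bq.
  by apply: depP; move: qi; rewrite qE; case: (parent p i) => // j'; case: ifP.
have root_uniq i : b i = lift ord0 l -> q i = None -> i = nth r js l.
  move=> bi /q_root[ir|/(nthP r)[l']].
    by move: (b_center i); rewrite bi ir eqxx.
  rewrite sz => l'm i'E; move: bi; rewrite -i'E b_js // => /(congr1 val).
  by rewrite /= inordK // => -[->].
have jl : nth r js l \in js by rewrite mem_nth // sz.
have [||e [f [rt [fP prt frt]]]] := block_exists x dq _ _ root_uniq.
- by apply/val_inj; rewrite b_js //= inordK // ltnS.
- by rewrite qE; move: jl; rewrite jsP => /eqP ->; rewrite eqxx.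
exists e; split; last by exists f.
apply/existsP; exists rt; rewrite prt eqxx /= /corolla_entry /=.
have [_ fb fq fx] := fP; have f_inj := block_emb_inj fP.
have bf j : b (f j) = lift ord0 l by apply/fb; exists j.
rewrite -(reads_transport (p := parent p) (x := tnth x) f_inj) //.
  by rewrite frt add0n; apply: Mjs_nth; rewrite size_Ms.
move=> c j; split=> [pc|[c' -> pc']]; last first.
  have := fq c'; rewrite pc' qE /=; case: (parent p (f c')) => // j'.
  by case: ifP.
have qc : q c = Some (f j).
  by rewrite qE pc -b_center bf.
have [|c' cE] := (fb c).1; first by rewrite -(bq _ _ qc) bf.
exists c' => //; move: qc; rewrite cE fq.
by case: (dparent e c') => //= y [/f_inj ->].
Qed.

End Branches.

(** * Normal forms *)

Lemma compose_at_tag (K : comNzRingType) (X : choiceType) r n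
    (z : box_at X r n) (u : dtree X) :
  (compose_at K z)@_u != 0 -> tag u = n.
Proof.
case: z => [[t [b q]] x]; rewrite /compose_at linext_coeff.
move=> /sum_neq0[t' [_ _]].
case: insub => [t2|]; last by rewrite mcoeff0 mulr0 eqxx.
by rewrite mcoeffU; case: (_ =P u) => [<- //|_]; rewrite mulr0 eqxx.
Qed.

(** The inductive step of the computation of [ev]: the entries [ws] are known to
    be the characteristic functions of the trees reading [Ms]. *)
Section Corolla.

Variables (K : comNzRingType) (X : choiceType) (a : X).
Variables (Ms : seq (monomial X)) (ws : seq {malg K[dtree X]}).

Hypothesis size_ws : size ws = size Ms.
Hypothesis ws_coeff : forall k e, (k < size Ms)%N ->
  (nth 0 ws k)@_e = (dreads (nth (Corolla a [::]) Ms k) e)%:R.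

Let w := in_tuple (orbit_sum K (corolla_dtree a [::]) :: ws).
Let sz : size Ms = size ws := esym size_ws.
Let supp (k : 'I_(size ws).+1) (e : dtree X) := dreads (corolla_entry a Ms k) e.
Let v := orbit_sum2 (corolla_dtree (orbit_sum K (corolla_dtree a [::])) ws).

Lemma entry_coeff k e : (tnth w k)@_e = (supp k e)%:R.
Proof.
rewrite (tnth_nth 0) /supp /corolla_entry;
  case: (unliftP ord0 k) => [l ->|->] /=.
  by rewrite add0n ws_coeff // -size_ws.
exact/orbit_sum_coeff/dreads_corolla0.
Qed.

(** A tree reading two entries makes them equivalent, hence read by the same
    trees. *)
Lemma entry_sep k l e : supp k e -> supp l e -> tnth w k = tnth w l.
Proof.
move=> ke le; apply/malgP => e'; rewrite !entry_coeff /supp.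
by rewrite (eq_upto_perm_dreads e' (dreads_inj ke le)).
Qed.

Lemma spread_branches z : (linext (@spread K X) v)@_z != 0 ->
  exists n (z' : box_at X (size ws).+1 n) s, z = Box z' /\ branches a Ms s z'.
Proof.
case: z => [[r n] [[t [b q]] x]] H.
have [d [vd blk]] :=
  linext_spread_support (b := b) (q := q) (x := x) (t := t) H.
have [s [d' [E d'P]]] := orbit_sum2_support entry_coeff vd.
have rE : (size ws).+1 = r by have := congr1 tag E.
move: t b q x d {H vd} blk E; case: r / rE => t b q x d blk E.
have {E} [tE dE] : (t, d) = (relabel s (corolla (size ws)), d') := Tagged_inj E.
exists n, (t, (b, q), x), s; split=> //; split=> //= k.
by exists (tnth d' k); rewrite -dE; split=> //; rewrite dE; apply: d'P.
Qed.

Lemma branches_spread n s (z : box_at X (size ws).+1 n) :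
  branches a Ms s z -> (linext (@spread K X) v)@_(Box z) = 1.
Proof.
case: z => [[t [b q]] x] [/= tE /fin_all_exists[e eP]].
rewrite (linext_spread_coeff _ _ (d := [tuple e k | k < (size ws).+1])).
  rewrite tE.
  apply: (@orbit_sum2_coeff1 K X (size ws).+1 _ w supp
            entry_coeff entry_sep) => k.
  by rewrite tnth_mktuple; case: (eP k).
by move=> k; rewrite tnth_mktuple; case: (eP k).
Qed.

Lemma mu_corolla u : (mu v)@_u = (dreads (Corolla a Ms) u)%:R.
Proof.
case: u => n [p x]; rewrite -/(DTree p x).
have [uM|uM] := boolP (dreads _ _); last first.
  apply/eqP; apply: contraNT uM => /mu_support[z [/spread_branches]].
  case=> n' [[[t [b q]] x'] [s [-> zP]]].
  rewrite -[tagged _]/(t, (b, q), x') => H.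
  have nn' : n = n' := compose_at_tag H;
    case: n' / nn' b q x' zP H => b q x' zP.
  have [i0 [b0 q0 x0]] := branches_center zP.
  rewrite (compose_at_coeff K q (branches_star zP) b0).
  case: (_ =P parent p) => [gp|_] /=; last by rewrite eqxx.
  case: (_ =P x) => [xx|_]; last by rewrite eqxx.
  by move=> _; rewrite -xx; apply: (branches_reads sz zP b0 q0 gp x0).
have [t [b [q [i0 [zP b0 q0 gp]]]]] := branches_exist sz uM.
apply: (mu_coeff1 (z0 := (t, (b, q), x))) => [g|g|z].
- exact: branches_spread (branches_act g zP).
- have gzP := branches_act g zP.
  rewrite (compose_at_coeff K q (branches_star gzP) (i0 := i0));
    rewrite ?gp ?eqxx // => i.
  by rewrite ffunE permM (inj_eq perm_inj).
case/spread_branches=> n' [[[t' [b' q']] x'] [s' [-> z'P]]].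
rewrite -[tagged _]/(t', (b', q'), x') => H.
have nn' : n = n' := compose_at_tag H;
  case: n' / nn' b' q' x' z'P H => b' q' x' z'P.
have [i0' [b0' q0' x0']] := branches_center z'P.
rewrite (compose_at_coeff K q' (branches_star z'P) b0').
case: (_ =P parent p) => [gp'|_] /=; last by rewrite eqxx.
case: (_ =P x) => [xx|_]; last by rewrite eqxx.
rewrite xx in z'P * => _.
exact: (branches_orbit zP z'P b0 q0 b0' q0' gp gp').
Qed.

End Corolla.

Lemma ev_coeff (K : comNzRingType) (X : choiceType) (M : monomial X) u :
  (ev K M)@_u = (dreads M u)%:R.
Proof.
elim/monomial_nth_ind: M u => a Ms IH u.
apply: (mu_corolla (size_map (@ev K X) Ms)) => k e kMs.
by rewrite (nth_map (Corolla a [::])) // IH.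
Qed.

Theorem proposition5p5 (K : comNzRingType) (X : choiceType) (t : dtree X) :
  exists M : monomial X,
    normal_form K t M /\
    (forall N : monomial X, normal_form K t N -> eq_upto_perm M N).
Proof.
have [M Mt] := dreads_exists t; exists M; split=> [|N].
  by apply/malgP => u; rewrite ev_coeff (orbit_sum_coeff _ _ Mt).
move/(congr1 (fun g => g@_t)); rewrite /= ev_coeff (orbit_sum_coeff _ _ Mt) Mt.
have [Nt _|_ /eqP] := boolP (dreads N t); first exact: dreads_inj Mt Nt.
by rewrite eq_sym oner_eq0.
Qed.
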